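(* Let $1\le p\le q\le\infty$, $q\ge 2$. Let $\hat\sigma$ be a Borel measure on $\hat{\mathbb S}$ for which there exist constants $C_{\hat\sigma}\ge 1$ and $0<\underline\delta\le\bar\delta\le\infty$, $\bar\delta\ge 1$, such that for every dyadic triangle $S\subseteq\hat{\mathbb S}$ $$\hat\sigma(S)\le C_{\hat\sigma}\,\hat\nu(S)^{1/\bar\delta}\ \text{ if } 0<\mathrm{diam}(S)<1,\qquad \hat\sigma(S)\le C_{\hat\sigma}\,\hat\nu(S)^{1/\underline\delta}\ \text{ if } \mathrm{diam}(S)\ge 1 .$$ Then $$\Vert u\Vert_{L^q(\hat\sigma)}\le C\sum_{i=1,2}\hat{\mathcal E}(u)^{a_i/2}\,\Vert u\Vert_{L^p(\hat\nu)}^{1-a_i},\qquad u\in\mathcal F(\hat{\mathbb S}),$$ where $$a_1=\Big[\frac{1/p-1/(q\bar\delta)}{1/p+1/(2\delta_s)}\Big]^+,\qquad a_2=\Big[\frac{1/p-1/(q\underline\delta)}{1/p+1/(2\delta_s)}\Big]^+,$$ and $C>0$ is a constant depending only on $C_{\hat\sigma}$. Moreover, if there exists a sequence $\{S_m\}_{m\in\mathbb Z}$ of dyadic triangles such that $\lim_{m\to-\infty}\mathrm{diam}(S_m)=0$, $\lim_{m\to\infty}\mathrm{diam}(S_m)=\infty$ and $$\frac1{\bar\delta}=\lim_{m\to-\infty}\frac{\log\hat\sigma(S_m)}{\log\hat\nu(S_m)},\qquad \frac1{\underline\delta}=\lim_{m\to\infty}\frac{\log\hat\sigma(S_m)}{\log\hat\nu(S_m)},$$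 then the pair $(a_1,a_2)$ is optimal in the following sense: if $$\Vert u\Vert_{L^q(\hat\sigma)}\le C\sum_{i=1}^N\hat{\mathcal E}(u)^{b_i/2}\,\Vert u\Vert_{L^p(\hat\nu)}^{1-b_i},\qquad u\in\mathcal F(\hat{\mathbb S}),$$ for some $N\in\mathbb N_+$, constants $b_i\in[0,1]$ ($1\le i\le N$) and $C>0$ independent of $u$, then $\min_i b_i\le a_2\le a_1\le\max_i b_i$.
   Context: Conventions: $1/\infty=0$, $[t]^+=\max(t,0)$, $\mathrm{diam}$ is the Euclidean diameter, and $\delta_s>0$ is defined by $1/\delta_s=\log 5/\log 3-1$. Compact gasket: let $\mathbf F_1(x)=\frac12x$, $\mathbf F_2(x)=\frac12(x+(1,0))$, $\mathbf F_3(x)=\frac12(x+(\frac12,\frac{\sqrt3}2))$ on $\mathbb R^2$, $\mathrm V_0=\{(0,0),(1,0),(\frac12,\frac{\sqrt3}2)\}$, $\mathrm V_m=\bigcup_{i=1}^3\mathbf F_i(\mathrm V_{m-1})$ for $m\ge1$, and $\mathbb S$ the closure of $\bigcup_m\mathrm V_m$. For a word $w=w_1\cdots w_m\in\{1,2,3\}^m$ put $\mathbf F_w=\mathbf F_{w_1}\circ\cdots\circ\mathbf F_{w_m}$ (identity if $m=0$) and $\mathbb S_w=\mathbf F_w(\mathbb S)$. The Hausdorff measure $\nu$ is the unique Borel probability measure on $\mathbb S$ with $\nu(\mathbb S_w)=3^{-m}$ for every word $w$ of length $m$, $m\ge0$. For a function $u$ on $\bigcup_m\mathrm V_m$ let $\mathcal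 E^{(m)}(u)=\frac12(5/3)^m\sum_{(x,y)}[u(x)-u(y)]^2$, the sum running over ordered pairs of distinct points $x,y$ that lie in a common set $\mathbf F_w(\mathrm V_0)$ with $w$ of length $m$. $\mathcal E^{(m)}(u)$ is non-decreasing in $m$; let $\mathcal E(u)=\lim_m\mathcal E^{(m)}(u)\in[0,\infty]$. Functions with $\mathcal E(u)<\infty$ extend uniquely to continuous functions on $\mathbb S$; the space of these is $\mathcal F(\mathbb S)\subseteq C(\mathbb S)$. Infinite gasket: $\hat{\mathbb S}=\bigcup_{k\ge0}2^k[\mathbb S\cup(-\mathbb S)]$. Let $\{\tau_i\}_{i\in\mathbb Z}$ be an enumeration without repetition of the distinct isometries $x\mapsto 2^k\mathbf F_w(x)$ and $x\mapsto-2^k\mathbf F_w(x)$, where $k\ge0$ and $w$ is a word of length $k$; then $\hat{\mathbb S}=\bigcup_{i\in\mathbb Z}\tau_i(\mathbb S)$ with non-overlapping pieces. The Hausdorff measure $\hat\nu$ on $\hat{\mathbb S}$ is the unique Borel measure with $\hat\nu(\tau_i(A))=\nu(A)$ for all Borel $A\subseteq\mathbb S$ and all $i$. For $u\in C(\hat{\mathbb S})$ let $\hat{\mathcal E}(u)=\sum_{i\in\mathbb Z}\mathcal E[(u\circ\tau_i)|_{\mathbb S}]$. $\mathcal F(\hat{\mathbb S})$ is the completion of $\{u\in C(\hat{\mathbb S})\cap L^2(\hat\nu):\hat{\mathcal E}(u)<\infty\}$ with respect to the norm $\hat{\mathcal E}(\cdot)^{1/2}+\Vert\cdot\Vert_{L^2(\hat\nu)}$;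 its elements are continuous functions on $\hat{\mathbb S}$ vanishing at infinity. A dyadic triangle is a set of the form $2^m\tau_i(\mathbb S)$ with $m,i\in\mathbb Z$. *)

(* Defs.v *)
From HB Require Import structures.
From mathcomp Require Export all_boot all_order all_algebra.
From mathcomp Require Export all_classical all_reals all_analysis.
Export Order.TTheory GRing.Theory Num.Theory.
Export numFieldNormedType.Exports.

Set Implicit Arguments.
Unset Strict Implicit.
Unset Printing Implicit Defensive.

#[global] Open Scope classical_set_scope.
#[global] Open Scope ring_scope.

Section Gasket.
Context {R : realType}.
Implicit Types (x y : R * R) (u : R * R -> R) (A : set (R * R)).

Definition scale (c : R) x : R * R := (c * x.1, c * x.2).

Definition edist x y : R :=
  Num.sqrt ((x.1 - y.1) ^+ 2 + (x.2 - y.2) ^+ 2).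

Definition diam A : \bar R :=
  ereal_sup [set (edist z.1 z.2)%:E | z in A `*` A].

(* The indices 1, 2, 3 of the contractions are the elements 0, 1, 2 of 'I_3. *)
Definition vertex (i : 'I_3) : R * R :=
  tnth [tuple (0, 0); (1, 0); (2^-1, Num.sqrt 3 / 2)] i.

Definition contraction (i : 'I_3) x : R * R :=
  scale 2^-1 (x.1 + (vertex i).1, x.2 + (vertex i).2).

Definition word_map (w : seq 'I_3) : R * R -> R * R :=
  foldr (fun i f => contraction i \o f) id w.

Definition V0 : set (R * R) := range vertex.

Fixpoint V (m : nat) : set (R * R) :=
  if m is m'.+1 then \bigcup_(i in [set: 'I_3]) contraction i @` V m' else V0.

Definition gasket : set (R * R) := closure (\bigcup_m V m).

(* Borel measures on the gasket are Borel measures on the plane for which the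
   complement is null; here this follows from the empty word, nu being a
   probability. *)
Definition is_gasket_measure (nu : probability (R * R)%type R) : Prop :=
  forall w : seq 'I_3, nu (word_map w @` gasket) = (3^-1 ^+ size w)%:E.

Definition edges (m : nat) : set ((R * R) * (R * R)) :=
  [set z | z.1 <> z.2 /\
    exists w : m.-tuple 'I_3, (word_map w @` V0) z.1 /\ (word_map w @` V0) z.2].

Definition energy_at (m : nat) u : R :=
  2^-1 * (5 / 3) ^+ m * \sum_(z \in edges m) (u z.1 - u z.2) ^+ 2.

Definition energy u : \bar R := limn (fun m => (energy_at m u)%:E).

Definition hgasket : set (R * R) :=
  \bigcup_k scale (2 ^+ k) @` (gasket `|` scale (-1) @` gasket).

(* A set of maps, so each of the distinct isometries tau_i occurs once. *)
Definition tile_maps : set (R * R -> R * R) :=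
  [set t | exists k (w : k.-tuple 'I_3),
     t = (fun x => scale (2 ^+ k) (word_map w x)) \/
     t = (fun x => scale (- 2 ^+ k) (word_map w x))].

Definition is_hgasket_measure (nu : probability (R * R)%type R)
    (hnu : {measure set (R * R)%type -> \bar R}) : Prop :=
  hnu (~` hgasket) = 0%E /\
  forall t A, tile_maps t -> measurable A -> A `<=` gasket ->
    hnu (t @` A) = nu A.

Definition henergy u : \bar R := (\esum_(t in tile_maps) energy (u \o t))%E.

Definition dyadic_triangle A : Prop :=
  exists (m : int) (t : R * R -> R * R),
    tile_maps t /\ A = scale (2 ^ m) @` (t @` gasket).

(* Functions on the infinite gasket are represented by functions on the plane
   whose values off the gasket are irrelevant: they are replaced by 0. *)
Definition hLnorm (mu : {measure set (R * R)%type -> \bar R}) (p : \bar R) u :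
  \bar R := Lnorm mu p (EFin \o (u \_ hgasket)).

Definition form_norm (hnu : {measure set (R * R)%type -> \bar R}) u : \bar R :=
  (henergy u `^ 2^-1 + hLnorm hnu 2%:E u)%E.

Definition form_core (hnu : {measure set (R * R)%type -> \bar R}) u : Prop :=
  [/\ {within hgasket, continuous u}, (hLnorm hnu 2%:E u < +oo)%E &
      (henergy u < +oo)%E].

Definition form_cauchy (hnu : {measure set (R * R)%type -> \bar R})
    (v : nat -> R * R -> R) : Prop :=
  forall eps : R, 0 < eps -> exists N : nat, forall m n : nat,
    (N <= m)%N -> (N <= n)%N -> (form_norm hnu (v m \- v n)%R < eps%:E)%E.

(* The completion of form_core: the class of a Cauchy sequence is identified
   with its pointwise limit, a continuous function. *)
Definition form_domain (hnu : {measure set (R * R)%type -> \bar R}) u : Prop :=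
  {within hgasket, continuous u} /\
  exists v : nat -> R * R -> R,
    [/\ forall n, form_core hnu (v n), form_cauchy hnu v &
        forall x, hgasket x -> v n x @[n --> \oo] --> u x].

(* inve +oo = 0 *)
Definition rinv (p : \bar R) : R := fine p^-1%E.

Definition inv_delta_s : R := ln 5 / ln 3 - 1.

(* The exponent [(1/p - 1/(q delta)) / (1/p + 1/(2 delta_s))]^+. *)
Definition sobolev_exponent (p q delta : \bar R) : R :=
  Num.max ((rinv p - rinv q * rinv delta) / (rinv p + inv_delta_s / 2)) 0.

Definition dyadic_growth (hnu sigma : {measure set (R * R)%type -> \bar R})
    (Csigma : R) (dlow dup : \bar R) : Prop :=
  forall S : set (R * R), dyadic_triangle S ->
    ((0 < diam S < 1)%E ->
       (sigma S <= Csigma%:E * hnu S `^ rinv dup)%E) /\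
    ((1 <= diam S)%E ->
       (sigma S <= Csigma%:E * hnu S `^ rinv dlow)%E).

Definition sobolev_term (hnu : {measure set (R * R)%type -> \bar R})
    (p : \bar R) (a : R) u : \bar R :=
  (henergy u `^ (a / 2) * hLnorm hnu p u `^ (1 - a))%E.

(* lne 0 = -oo *)
Definition log_ratio (hnu sigma : {measure set (R * R)%type -> \bar R}) A :
  \bar R := (lne (sigma A) / lne (hnu A))%E.

End Gasket.

(* Main.v *)
Require Import Defs.
From mathcomp Require Import measurable_realfun ess_sup_inf finmap zify ring lra.

Set Implicit Arguments.
Unset Strict Implicit.
Unset Printing Implicit Defensive.

(* On a cell T of side 2^m, of measure s = 3^m, the oscillation of u is at most
   10 (s^(1/delta_s) E_T(u))^(1/2), since points of the gasket are joined to the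
   boundary by chains with geometrically decreasing resistances, while the
   infimum a_T of |u| over T satisfies a_T^p s <= int_T |u|^p. Summing over the
   cells of a level, with l^p and l^2 embedded in l^q, gives
     ||u||_q <= C s^(1/(q delta)) (s^(-1/p) ||u||_p + s^(1/(2 delta_s)) E(u)^(1/2))
   for delta = dup if s < 1 and delta = dlow if s >= 1. The level at which the two
   terms balance yields the inequality; when the exponent for dlow is negative,
   the level s = 1 is used instead. For the optimality, the test function attached
   to a cell T is the piecewise harmonic function equal to 1 at the vertices of T
   and to 0 at the other vertices of the same level; its energy is comparable to
   s^(-1/delta_s), its L^p norm to s^(1/p), and its L^q(sigma) norm is at least
   sigma(T)^(1/q). *)

(** * Geometry of the gasket *)

Section Geometry.
Context {R : realType}.
Implicit Types (x y : R * R) (i j : 'I_3) (w v : seq 'I_3).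

(** The level is the only free parameter. With s = expR t the two terms agree, up to constants, at t
    = (ln ||u||_p - ln E(u) / 2) / k, where k = 1/p + 1/(2 delta_s); inserting this t gives
    E(u)^(a/2) ||u||_p^(1 - a) with a = (1/p - 1/(q delta)) / k. Since the growth hypothesis changes
    at diameter 1, t is rounded down to a multiple of ln 3, which never crosses 0 and costs a factor
    of at most 3. As 1/p and 1/q lie in [0, 1], the final constant is 26 times that of sigma,
    uniformly in the exponents. The infinite gasket has no largest cell, so estimates are made on an
    exhaustion by finitely many cells and then pass to the limit. For the optimality, a term with
    exponent b is of order at most s^(1/p - b k) on a test function. The smallest b_i dominates for
    large s and the largest for small s; the logarithm of the inequality, divided by ln s, gives one
    bound at each end. *)

Lemma I3P (P : 'I_3 -> Prop) :
  P (@Ordinal 3 0 isT) -> P (@Ordinal 3 1 isT) -> P (@Ordinal 3 2 isT) ->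
  forall i, P i.
Proof.
move=> P0 P1 P2 [[|[|[|//]]] lti].
- by rewrite (_ : Ordinal lti = @Ordinal 3 0 isT)//; exact: val_inj.
- by rewrite (_ : Ordinal lti = @Ordinal 3 1 isT)//; exact: val_inj.
- by rewrite (_ : Ordinal lti = @Ordinal 3 2 isT)//; exact: val_inj.
Qed.

Lemma big_I3 (T : Type) (idx : T) (op : Monoid.law idx) (F : 'I_3 -> T) :
  \big[op/idx]_(i < 3) F i =
  op (op (F (@Ordinal 3 0 isT)) (F (@Ordinal 3 1 isT))) (F (@Ordinal 3 2 isT)).
Proof.
rewrite !big_ord_recr big_ord0 /= Monoid.mul1m.
by congr (op (op (F _) (F _)) (F _)); exact: val_inj.
Qed.

Let r3 : R := Num.sqrt 3.

Let r3_gt0 : 0 < r3. Proof. by rewrite sqrtr_gt0. Qed.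

Let r3_sqr : r3 * r3 = 3. Proof. by rewrite -expr2 sqr_sqrtr. Qed.

(* Barycentric coordinates with respect to the three vertices. *)
Definition lam i x : R :=
  match val i with
  | 0%N => 1 - x.1 - x.2 / Num.sqrt 3
  | 1%N => x.1 - x.2 / Num.sqrt 3
  | _ => 2 * x.2 / Num.sqrt 3
  end.

Lemma lam_vertex i j : lam j (vertex i) = (j == i)%:R.
Proof.
have r30 : r3 != 0 by rewrite gt_eqF.
elim/I3P: i; elim/I3P: j; rewrite /lam /vertex /tnth /= -/r3; field; done.
Qed.

Lemma lam_contraction i j x :
  lam j (contraction i x) = (lam j x + (j == i)%:R) / 2.
Proof.
have r30 : r3 != 0 by rewrite gt_eqF.
elim/I3P: i; elim/I3P: j;
  rewrite /lam /contraction /scale /vertex /tnth /= -/r3; field; done.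
Qed.

Lemma lam_sum x : \sum_i lam i x = 1.
Proof. by rewrite big_I3/= /lam/=; ring. Qed.

Lemma lam_inj x y : (forall j, lam j x = lam j y) -> x = y.
Proof.
move=> e; have r30 : r3 != 0 by rewrite gt_eqF.
have := e (@Ordinal 3 1 isT); have := e (@Ordinal 3 2 isT).
rewrite /lam/= -/r3 => e2 e1.
have xy2 : x.2 = y.2 by move: e2 => /(mulIf (invr_neq0 r30)); lra.
by case: x y e1 {e e2} xy2 => [x1 x2] [y1 y2]/= + xy2; rewrite xy2 => e1; congr pair; lra.
Qed.

Lemma edist_lam x y : edist x y =
  Num.sqrt (2^-1 * \sum_j (lam j x - lam j y) ^+ 2).
Proof.
congr Num.sqrt; rewrite big_I3/= /lam/= -/r3.
have r30 : r3 != 0 by rewrite gt_eqF.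
have e z : z ^+ 2 = 3 * (z / r3) ^+ 2.
  by rewrite expr_div_n expr2 -/r3 (expr2 r3) r3_sqr; field.
rewrite (e (x.2 - y.2)); field; done.
Qed.

Lemma lam_continuous i : continuous (lam i).
Proof.
have c1 x : (fun y : R * R => y.1) @ x --> x.1 by exact: cvg_fst.
have c2 x : (fun y : R * R => y.2) @ x --> x.2 by exact: cvg_snd.
elim/I3P: i => x; rewrite /lam/=.
- apply: cvgB; last by apply: cvgMl; exact: c2.
  by apply: cvgB; [exact: cvg_cst|exact: c1].
- by apply: cvgB; [exact: c1|apply: cvgMl; exact: c2].
- by apply: cvgMl; apply: cvgMr; exact: c2.
Qed.

Lemma contraction_inj i : injective (@contraction R i).
Proof.
move=> x y e; apply: lam_inj => j.
have := congr1 (lam j) e; rewrite !lam_contraction; lra.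
Qed.

Lemma vertex_inj : injective (@vertex R).
Proof.
move=> i j e; have := congr1 (lam i) e; rewrite !lam_vertex eqxx.
by case: eqP => // _ /eqP; rewrite oner_eq0.
Qed.

Lemma contraction_vertex i : contraction i (@vertex R i) = vertex i.
Proof. by apply: lam_inj => j; rewrite lam_contraction !lam_vertex; lra. Qed.

Lemma contraction_vertexC i j :
  contraction i (@vertex R j) = contraction j (vertex i).
Proof. by apply: lam_inj => k; rewrite !lam_contraction !lam_vertex addrC. Qed.

Lemma word_map_cat w v x :
  word_map (w ++ v) x = word_map w (@word_map R v x).
Proof. by elim: w => //= i w ->. Qed.

Lemma word_map_inj w : injective (@word_map R w).
Proof. by elim: w => // i w IH x y /contraction_inj/IH. Qed.

Lemma lam_word_mapB w j x y :
  lam j (word_map w x) - lam j (word_map w y)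
  = 2^-1 ^+ size w * (lam j x - lam j y).
Proof.
elim: w => [|i w IH] /=; first by rewrite expr0 mul1r.
by rewrite !lam_contraction exprS -mulrA -IH; lra.
Qed.

(** The solid triangle with corners [V0]. Intersections of cells are computed in it, because
    membership is a sign condition on barycentric coordinates. *)
Definition triangle : set (R * R) := [set x | forall j, 0 <= lam j x].

Lemma triangle_lam_le1 x j : triangle x -> lam j x <= 1.
Proof.
move=> Tx; rewrite -(lam_sum x) (bigD1 j)//= lerDl.
by apply: sumr_ge0 => i _; exact: Tx.
Qed.

Lemma triangle_lam1 x j : triangle x -> lam j x = 1 -> x = vertex j.
Proof.
move=> Tx xj; apply: lam_inj => i; rewrite lam_vertex.
case: eqP => [->//|/eqP ij].
have := lam_sum x; rewrite (bigD1 j)//= xj => /(congr1 (fun z => z - 1)).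
rewrite subrr addrAC subrr add0r => /eqP; rewrite psumr_eq0//.
by move/allP => /(_ i); rewrite mem_index_enum ij => /(_ isT)/eqP.
Qed.

Lemma triangle_contraction i x : triangle x -> triangle (contraction i x).
Proof.
by move=> Tx j; rewrite lam_contraction divr_ge0// addr_ge0// ler0n.
Qed.

Lemma triangle_word_map w x : triangle x -> triangle (word_map w x).
Proof. by elim: w => //= i w IH /IH; exact: triangle_contraction. Qed.

Lemma triangle_vertex i : triangle (vertex i).
Proof. by move=> j; rewrite lam_vertex ler0n. Qed.

(** A corner is an extreme point: coordinate j of the average of a point and [vertex i] reaches 1
    only if i = j and the point itself has coordinate 1. *)
Lemma word_map_vertex_inv w x j :
  triangle x -> word_map w x = vertex j -> x = vertex j.
Proof.
move=> Tx; elim: w => //= i w IH e.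
have Tw := triangle_word_map w Tx.
have := congr1 (lam j) e; rewrite lam_contraction lam_vertex eqxx => e1.
apply: IH; apply: triangle_lam1 => //.
have := triangle_lam_le1 j Tw; case: (j == i) e1 => /= e1; lra.
Qed.

(** Coordinate j is at most 1/2 on the i-th cell and at least 1/2 on the j-th. At a common point it
    is 1/2, which forces [lam j x = 1]. *)
Lemma contraction_meet i j x y : i != j -> triangle x -> triangle y ->
  contraction i x = contraction j y -> x = vertex j.
Proof.
move=> ij Tx Ty /(congr1 (lam j)); rewrite !lam_contraction eqxx eq_sym.
rewrite (negbTE ij) => e; apply: triangle_lam1 => //.
by have := triangle_lam_le1 j Tx; have := Ty j; move=> /= in e *; lra.
Qed.

(* Since i depends neither on x nor on y, two distinct cells of the same level
   share at most one point. *)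
Lemma word_map_meet w v : size w = size v -> w != v ->
  exists i, forall x y, triangle x -> triangle y ->
    word_map w x = word_map v y -> x = vertex i.
Proof.
elim: w v => [|i w IH] [|j v]//= [sz]; have [<-|ij] := eqVneq i j.
  rewrite eqseq_cons eqxx/= => /(IH _ sz)[k kP]; exists k => x y Tx Ty.
  by move=> /contraction_inj; exact: kP.
move=> _; exists j => x y Tx Ty e.
apply: (@word_map_vertex_inv w) => //.
exact: (contraction_meet ij (triangle_word_map _ Tx) (triangle_word_map _ Ty) e).
Qed.

Lemma gasket_triangle : gasket `<=` triangle.
Proof.
have -> : triangle = \bigcap_(j in [set: 'I_3]) [set x | 0 <= lam j x].
  by apply/seteqP; split => x /= Tx j *; exact: Tx.
suff VT : \bigcup_m V m `<=` triangle.
  have cl : closed (\bigcap_(j in [set: 'I_3]) [set x | 0 <= lam j x]).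
    apply: closed_bigI => j _.
    have -> : [set x | 0 <= lam j x] = lam j @^-1` [set t : R | 0 <= t] by [].
    by apply: closed_comp => [x _|]; [exact: lam_continuous|exact: closed_ge].
  rewrite [X in _ `<=` X](_ : _ = closure (\bigcap_(j in [set: 'I_3]) [set x | 0 <= lam j x])).
    by apply: closure_subset => x /VT Tx j _; exact: Tx.
  by apply/closure_id.
move=> x [m _]; elim: m x => [|m IH] x /=; first by move=> [k _ <-]; exact: triangle_vertex.
by move=> [k _ [y Vy <-]]; apply: triangle_contraction; exact: IH.
Qed.

Lemma gasket_vertex i : gasket (@vertex R i).
Proof. by apply: subset_closure; exists 0%N => //; exists i. Qed.

Lemma V_word m x : (@V R m) x <-> exists w i, size w = m /\ x = word_map w (vertex i).
Proof.
elim: m x => [|m IH] x /=.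
  split=> [[i _ <-]|[w [i [/size0nil -> ->]]]]; last by exists i.
  by exists [::], i.
split=> [[i _ [y /IH[w [j [<- ->]]] <-]]|]; first by exists (i :: w), j.
case=> -[|i w] [j [//= [sz] ->]]; exists i => //; exists (word_map w (vertex j)) => //.
by apply/IH; exists w, j.
Qed.

Lemma contraction_continuous i : continuous (@contraction R i).
Proof.
move=> x; apply: (@cvg_pair _ _ _ _ (nbhs _) (nbhs _)) => /=.
- by apply: cvgMr; apply: cvgD; [exact: cvg_fst|exact: cvg_cst].
- by apply: cvgMr; apply: cvgD; [exact: cvg_snd|exact: cvg_cst].
Qed.

Lemma scale_continuous (c : R) : continuous (scale c).
Proof.
move=> x; apply: (@cvg_pair _ _ _ _ (nbhs _) (nbhs _)) => /=.
- by apply: cvgMr; exact: cvg_fst.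
- by apply: cvgMr; exact: cvg_snd.
Qed.

Lemma word_map_continuous w : continuous (@word_map R w).
Proof.
elim: w => [|i w IH] x /=; first exact: cvg_id.
by apply: continuous_comp; [exact: IH|exact: contraction_continuous].
Qed.

End Geometry.

(** * Tiles, cells and the exhaustion of the infinite gasket *)

Section Tiles.
Context {R : realType}.
Implicit Types (x y : R * R) (i j : 'I_3) (w v : seq 'I_3) (e : bool).

Definition contractionV i y : R * R :=
  (2 * y.1 - (vertex i).1, 2 * y.2 - (vertex i).2).

Lemma contractionK i : cancel (contraction i) (contractionV i).
Proof. by case=> x1 x2; rewrite /contraction /contractionV/=; congr pair; lra. Qed.

Lemma contractionVK i : cancel (contractionV i) (contraction i).
Proof. by case=> x1 x2; rewrite /contraction /scale /contractionV/=; congr pair; lra. Qed.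

Lemma contractionV_continuous i : continuous (contractionV i).
Proof.
move=> x; apply: (@cvg_pair _ _ _ _ (nbhs _) (nbhs _)) => /=.
- by apply: cvgB; [apply: cvgMr; exact: cvg_fst|exact: cvg_cst].
- by apply: cvgB; [apply: cvgMr; exact: cvg_snd|exact: cvg_cst].
Qed.

Definition word_mapV w y : R * R := foldl (fun z i => contractionV i z) y w.

Lemma word_mapK w : cancel (word_map w) (word_mapV w).
Proof. by elim: w => //= i w IH x; rewrite /word_mapV/= contractionK; exact: IH. Qed.

Lemma word_mapVK w : cancel (word_mapV w) (word_map w).
Proof.
elim: w => //= i w IH x.
by rewrite -[RHS](contractionVK i); congr contraction; exact: IH.
Qed.

Lemma word_mapV_continuous w : continuous (word_mapV w).
Proof.
elim: w => [|i w IH] x; first exact: cvg_id.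
apply: (@continuous_comp _ _ _ (contractionV i) (word_mapV w)).
  exact: contractionV_continuous.
exact: IH.
Qed.

(* The word may have any length: these maps parametrise the dyadic triangles of
   all levels k - size w, and the tiles are those with size w = k. *)
Definition tile e (k : nat) w x : R * R :=
  scale ((-1) ^+ e * 2 ^+ k) (word_map w x).

Definition tileV e (k : nat) w x : R * R :=
  word_mapV w (scale ((-1) ^+ e * 2 ^+ k)^-1 x).

Lemma scaleA (a b : R) x : scale a (scale b x) = scale (a * b) x.
Proof. by rewrite /scale/= !mulrA. Qed.

Lemma scale1 x : scale 1 x = x.
Proof. by case: x => a b; rewrite /scale/= !mul1r. Qed.

Lemma tile_coef_neq0 e k : (-1) ^+ e * 2 ^+ k != 0 :> R.
Proof. by rewrite mulf_neq0 ?signr_eq0// expf_neq0// pnatr_eq0. Qed.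

Lemma tileK e k w : cancel (tile e k w) (tileV e k w).
Proof.
move=> x; rewrite /tile /tileV scaleA mulVf ?tile_coef_neq0// scale1.
exact: word_mapK.
Qed.

Lemma tileVK e k w : cancel (tileV e k w) (tile e k w).
Proof.
by move=> x; rewrite /tile /tileV word_mapVK scaleA mulfV ?tile_coef_neq0// scale1.
Qed.

Lemma tile_continuous e k w : continuous (tile e k w).
Proof.
move=> x; apply: (@continuous_comp _ _ _ (word_map w) (scale _)).
  exact: word_map_continuous.
exact: scale_continuous.
Qed.

Lemma tileV_continuous e k w : continuous (tileV e k w).
Proof.
move=> x; apply: (@continuous_comp _ _ _ (scale _) (word_mapV w)).
  exact: scale_continuous.
exact: word_mapV_continuous.
Qed.

Lemma tile_cat e k w v x : tile e k (w ++ v) x = tile e k w (word_map v x).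
Proof. by rewrite /tile word_map_cat. Qed.

(** Vertex 0 is the origin, so the letter [ord0] halves and cancels the doubled scale. A tile
    therefore has many names, and finitely many tiles can be written with one common scale. *)
Lemma tile_pad e k w : tile e k w = tile e k.+1 (ord0 :: w).
Proof.
apply/funext => x; rewrite /tile /= /contraction scaleA exprS.
set c := (-1) ^+ e; set d := 2 ^+ k; case: (word_map w x) => a b.
by rewrite /scale /vertex /tnth/=; congr pair; field.
Qed.

Lemma tile_padn n e k w : tile e k w = tile e (k + n) (nseq n ord0 ++ w).
Proof.
elim: n => [|n IH]; first by rewrite addn0.
by rewrite addnS -[nseq n.+1 _ ++ _]/(ord0 :: (nseq n ord0 ++ w)) -tile_pad.
Qed.

Lemma tile_mapsP (t : R * R -> R * R) :
  tile_maps t <-> exists e (w : seq 'I_3), t = tile e (size w) w.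
Proof.
split=> [[k [w []->]]|[e [w ->]]].
- by exists false, w; apply/funext => x; rewrite /tile size_tuple expr0 mul1r.
- by exists true, w; apply/funext => x; rewrite /tile size_tuple expr1 mulN1r.
- exists (size w), (in_tuple w); case: e; [right|left]; apply/funext => x.
    by rewrite /tile expr1 mulN1r.
  by rewrite /tile expr0 mul1r.
Qed.

Lemma tile_maps_pad (t : R * R -> R * R) : tile_maps t ->
  exists K0, forall K, (K0 <= K)%N -> exists e w, size w = K /\ t = tile e K w.
Proof.
move=> /tile_mapsP[e [w ->]]; exists (size w) => K wK.
exists e, (nseq (K - size w) ord0 ++ w); split.
  by rewrite size_cat size_nseq subnK.
by rewrite (tile_padn (K - size w)) subnKC.
Qed.

Lemma tile_tile_maps e w : tile_maps (tile e (size w) w).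
Proof. by apply/tile_mapsP; exists e, w. Qed.

Lemma closed_contraction_image i (A : set (R * R)) :
  closed A -> closed (contraction i @` A).
Proof.
move=> cA; rewrite (_ : _ @` A = contractionV i @^-1` A).
  by apply: closed_comp => // x _; exact: contractionV_continuous.
apply/seteqP; split => [_ [x Ax <-]|x Ax] /=; first by rewrite contractionK.
by exists (contractionV i x) => //; rewrite contractionVK.
Qed.

Lemma closed_gasket : closed (@gasket R). Proof. exact: closed_closure. Qed.

Lemma gasket_contraction i x : gasket x -> gasket (contraction i x).
Proof.
move=> Gx B /(contraction_continuous (x := x)) /Gx [y [[m _ Vy] By]].
exists (contraction i y); split => //; exists m.+1 => //.
by exists i => //; exists y.
Qed.

Lemma gasket_word_map w x : gasket x -> gasket (word_map w x).
Proof. by elim: w => //= i w IH /IH; exact: gasket_contraction. Qed.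

(** The union of the three closed images is closed and contains every [V m], hence also the
    closure. *)
Lemma gasket_split x : gasket x ->
  exists i y, gasket y /\ x = contraction i y.
Proof.
have cU : closed (\bigcup_(i in [set: 'I_3]) contraction i @` (@gasket R)).
  apply: closed_bigcup => [|i _]; first exact: finite_finset.
  by apply: closed_contraction_image; exact: closed_gasket.
suff VU : \bigcup_m (@V R m) `<=` \bigcup_(i in [set: 'I_3]) contraction i @` (@gasket R).
  move=> Gx; have /closure_id e := cU.
  have : closure (\bigcup_(i in [set: 'I_3]) contraction i @` (@gasket R)) x.
    exact: (closure_subset VU).
  by rewrite -e => -[i _ [y Gy <-]]; exists i, y.
move=> z [m _ /V_word[w [i [_ ->]]]].
case: w => [|j w]/=.
  exists i => //; exists (vertex i); first exact: gasket_vertex.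
  by rewrite contraction_vertex.
exists j => //; exists (word_map w (vertex i)) => //.
by apply: gasket_word_map; exact: gasket_vertex.
Qed.

Lemma gasket_word_split n x : gasket x ->
  exists w y, [/\ size w = n, gasket y & x = word_map w y].
Proof.
elim: n x => [|n IH] x Gx; first by exists [::], x.
have [i [y [Gy ->]]] := gasket_split Gx.
by have [w [z [<- Gz ->]]] := IH _ Gy; exists (i :: w), z.
Qed.

(* A linear functional, nonnegative on the gasket and at least 1/2 on the two cells
   away from the origin; its size bounds the scale at which a point occurs. *)
Definition ell x : R := 1 - lam ord0 x.

Lemma ell_scale c x : ell (scale c x) = c * ell x.
Proof. by rewrite /ell /lam/=; ring. Qed.

Lemma ell_continuous : continuous ell.
Proof. by move=> x; apply: cvgB; [exact: cvg_cst|exact: lam_continuous]. Qed.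

(** Equal signs reduce to [word_map_meet]. For opposite signs [ell] is nonnegative on one side and
    nonpositive on the other, so the common point is the origin, whose coordinate 0 equals 1. *)
Lemma tile_meet e e' k w v : size w = size v -> (e, w) != (e', v) ->
  exists i, forall x y, triangle x -> triangle y ->
    tile e k w x = tile e' k v y -> x = vertex i.
Proof.
move=> sz; rewrite xpair_eqE negb_and; have [<-|ee' _] := eqVneq e e'.
  move=> /= /(word_map_meet (R := R) sz)[i iP]; exists i => x y Tx Ty E.
  apply: (iP x y Tx Ty); have := congr1 (scale ((-1) ^+ e * 2 ^+ k)^-1) E.
  by rewrite /tile !scaleA mulVf ?tile_coef_neq0// !scale1.
exists ord0 => x y Tx Ty E; apply: (@word_map_vertex_inv _ w) => //.
have Tw := triangle_word_map w Tx; have Tv := triangle_word_map v Ty.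
apply: triangle_lam1 => //.
have := congr1 ell E; rewrite /tile !ell_scale /ell => E'.
have k0 : 0 < 2 ^+ k :> R by rewrite exprn_gt0.
have Tw1 := triangle_lam_le1 ord0 Tw; have Tv1 := triangle_lam_le1 ord0 Tv.
set a := lam ord0 (word_map w x) in E' Tw1 *.
set b := lam ord0 (word_map v y) in E' Tv1 *.
have {}E' : 2 ^+ k * (1 - a) = - (2 ^+ k * (1 - b)).
  by move: ee' E'; case: (e) (e') => -[]//= _; rewrite !(expr0, expr1); lra.
have a1 : 2 ^+ k * (1 - a) = 0.
  apply/eqP; rewrite eq_le; apply/andP; split.
    by rewrite E' oppr_le0 mulr_ge0 ?subr_ge0// ltW.
  by rewrite mulr_ge0 ?subr_ge0// ltW.
by move/eqP: a1; rewrite mulf_eq0 gt_eqF//= subr_eq0 => /eqP.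
Qed.

Lemma tile_inj e e' k w v : size w = size v -> tile e k w = tile e' k v ->
  (e, w) = (e', v).
Proof.
move=> sz E; apply: contrapT => /eqP /(tile_meet k sz)[i iP].
(* If the two maps coincided, all three vertices would be the one exceptional vertex i. *)
have h j : i = j.
  apply: vertex_inj; symmetry; apply: (iP (vertex j) (vertex j)).
  - exact: triangle_vertex.
  - exact: triangle_vertex.
  - by rewrite E.
by have := h (@Ordinal 3 1 isT); rewrite (h (@Ordinal 3 2 isT)).
Qed.

Definition cell e k w : set (R * R) := tile e k w @` gasket.

Lemma cellE e k w : cell e k w = tileV e k w @^-1` gasket.
Proof.
apply/seteqP; split => [_ [x Gx <-]|x Gx] /=; first by rewrite tileK.
by exists (tileV e k w x) => //; rewrite tileVK.
Qed.

Lemma closed_cell e k w : closed (cell e k w).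
Proof.
rewrite cellE; apply: closed_comp; last exact: closed_gasket.
by move=> x _; exact: tileV_continuous.
Qed.

Lemma hgasketP x : hgasket x <-> exists e k, cell e k [::] x.
Proof.
split=> [[k _ [y [Gy|[z Gz <-]] <-]]|[e [k [y Gy <-]]]].
- by exists false, k, y => //; rewrite /tile/= expr0 mul1r.
- by exists true, k, z => //; rewrite /tile/= expr1 scaleA mulrN1 mulN1r.
- exists k => //; case: e; last first.
    by exists y; [left|rewrite /tile/= expr0 mul1r].
  exists (scale (-1) y); first by right; exists y.
  by rewrite /tile/= expr1 scaleA mulrN1 mulN1r.
Qed.

Definition exhaustion (a : nat) : set (R * R) := cell false a [::] `|` cell true a [::].

Lemma exhaustionP a x : exhaustion a x <-> exists e, cell e a [::] x.
Proof.
by split=> [[|]|[[|]]]; [exists false|exists true|right|left].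
Qed.

Lemma cell_nil e k w : cell e k w `<=` cell e k [::].
Proof.
move=> _ [y Gy <-]; exists (word_map w y) => //; exact: gasket_word_map.
Qed.

Lemma cell_padn n e k w : cell e k w = cell e (k + n) (nseq n ord0 ++ w).
Proof. by rewrite /cell -tile_padn. Qed.

Lemma exhaustion_mono a b : (a <= b)%N -> exhaustion a `<=` exhaustion b.
Proof.
move=> ab x /exhaustionP[e cx]; apply/exhaustionP; exists e.
rewrite (cell_padn (b - a)) subnKC// in cx; exact: cell_nil cx.
Qed.

Lemma hgasket_exhaustion : hgasket = \bigcup_a exhaustion a.
Proof.
apply/seteqP; split => x.
  by move=> /hgasketP[e [k cx]]; exists k => //; apply/exhaustionP; exists e.
by move=> [k _ /exhaustionP[e cx]]; apply/hgasketP; exists e, k.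
Qed.

Lemma cell_hgasket e k w : cell e k w `<=` hgasket.
Proof. by move=> x /cell_nil cx; apply/hgasketP; exists e, k. Qed.

Lemma tile_hgasket e k w x : gasket x -> hgasket (tile e k w x).
Proof. by move=> Gx; apply: (@cell_hgasket e k w); exists x. Qed.

Lemma cell_split n e k w x : cell e k w x ->
  exists v, size v = n /\ cell e k (w ++ v) x.
Proof.
move=> [y /(gasket_word_split n)[v [z [sv Gz ->]]] <-]; exists v; split => //.
by exists z => //; rewrite tile_cat.
Qed.

Lemma exhaustion_split n a x : exhaustion a x -> exists e w, size w = n /\ cell e a w x.
Proof. by move=> /exhaustionP[e /(cell_split n)[v [sv cx]]]; exists e, v. Qed.

(** Descent on the scale: at scale k + 1, a cell whose word starts with a letter other than [ord0]
    has |ell| at least 2 ^ k, so a smaller value puts the point back into scale k. This keeps the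
    points of the gasket near a given one inside a single exhaustion set. *)
Lemma ell_exhaustion a x : hgasket x -> `|ell x| < 2 ^+ a -> exhaustion a x.
Proof.
move=> /hgasketP[e [k cx]]; have : exhaustion k x by apply/exhaustionP; exists e.
move=> {e cx}; elim: k => [|k IH] bx ex; first exact: (exhaustion_mono _ bx).
have [ka|ak] := leqP k.+1 a; first exact: (exhaustion_mono ka).
apply: IH => //; have [e [w [sw cw]]] := exhaustion_split 1 bx.
case: w sw cw => [|i [|]]// _ [y Gy E].
apply/exhaustionP; exists e; exists y => //; rewrite tile_pad -E.
suff -> : i = ord0 by [].
apply: contrapT => /eqP i0; move: ex; rewrite -E /tile ell_scale normrM /=.
rewrite /ell lam_contraction eq_sym (negbTE i0) addr0 ltNge => /negP; apply.
rewrite normrM normr_sign mul1r ger0_norm ?exprn_ge0//.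
have Ty1 := triangle_lam_le1 ord0 (gasket_triangle Gy).
rewrite (@le_trans _ _ (2 ^+ k.+1 * 2^-1))//.
  by rewrite exprSr mulfK// ler_eXn2l// ltr1n.
rewrite ler_pM2l ?exprn_gt0// ger0_norm; lra.
Qed.

(** Positive powers of 2 go into the scale [k], negative ones into letters [ord0] in front of the
    word; conversely the power is the scale minus the word length. *)
Lemma dyadic_cellP (A : set (R * R)) :
  dyadic_triangle A <-> exists e k w, A = cell e k w.
Proof.
have sc (c : R) e k w : scale c @` (tile e k w @` gasket) =
    (fun x => scale (c * ((-1) ^+ e * 2 ^+ k)) (word_map w x)) @` gasket.
  by rewrite image_comp; apply: eq_imagel => x _ /=; rewrite /tile scaleA.
split=> [[m [t [/tile_mapsP[e [w ->]] ->]]]|[e [k [w ->]]]].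
  case: m => n.
    exists e, (size w + n)%N, w; rewrite sc; apply: eq_imagel => x _.
    by rewrite /tile mulrCA -exprD addnC.
  exists e, (size w), (nseq n.+1 ord0 ++ w).
  rewrite (tile_padn n.+1 e) sc; apply: eq_imagel => x _.
  rewrite /tile -[(2 : R) ^ Negz n]/((2 ^+ n.+1)^-1) exprD.
  by congr scale; rewrite mulrCA; congr (_ * _); rewrite mulrCA mulVf ?mulr1// expf_neq0.
exists (k%:Z - (size w)%:Z), (tile e (size w) w); split; first exact: tile_tile_maps.
rewrite sc; apply: eq_imagel => x _; rewrite /tile expfzDr// -exprnN.
by congr scale; rewrite mulrCA; congr (_ * _); rewrite -mulrA mulVf ?mulr1// expf_neq0.
Qed.

Lemma edist_tile e k w x y :
  edist (tile e k w x) (tile e k w y) = 2 ^+ k / 2 ^+ size w * edist x y.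
Proof.
have sc c a b : edist (scale c a) (scale c b) = `|c| * edist a b.
  rewrite /edist/= -!mulrBr !exprMn -mulrDr sqrtrM ?sqr_ge0//.
  by rewrite sqrtr_sqr.
rewrite sc normrM normr_sign mul1r ger0_norm ?exprn_ge0// -mulrA; congr (_ * _).
rewrite !edist_lam -exprVn -[X in X * Num.sqrt _]ger0_norm ?exprn_ge0//.
rewrite -sqrtr_sqr -sqrtrM ?sqr_ge0//; congr Num.sqrt.
rewrite mulrCA; congr (_ * _); rewrite mulr_sumr; apply: eq_bigr => j _.
by rewrite lam_word_mapB exprMn.
Qed.

Lemma edist_triangle x y : triangle x -> triangle y -> edist x y <= 1.
Proof.
move=> Tx Ty; rewrite edist_lam -[leRHS]sqrtr1 ler_sqrt//.
have := lam_sum x; have := lam_sum y; rewrite !big_I3/=.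
have := (Tx (@Ordinal 3 0 isT), Tx (@Ordinal 3 1 isT), Tx (@Ordinal 3 2 isT)).
have := (Ty (@Ordinal 3 0 isT), Ty (@Ordinal 3 1 isT), Ty (@Ordinal 3 2 isT)).
move: (lam _ x) (lam _ x) (lam _ x) (lam _ y) (lam _ y) (lam _ y).
move=> a b c a' b' c' [[a0 b0] c0] [[a1 b1] c1] s s'.
nra.
Qed.

Lemma diam_cell e k w : diam (cell e k w) = (2 ^+ k / 2 ^+ size w)%:E.
Proof.
have c0 : 0 <= 2 ^+ k / 2 ^+ size w :> R by rewrite divr_ge0// exprn_ge0.
apply/eqP; rewrite eq_le; apply/andP; split.
  apply: ge_ereal_sup => _ [[_ _] [/= [x Gx <-] [y Gy <-]] <-].
  rewrite lee_fin edist_tile ler_piMr//.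
  by apply: edist_triangle; exact: gasket_triangle.
apply: ereal_sup_ubound => /=.
exists (tile e k w (vertex ord0), tile e k w (vertex (@Ordinal 3 1 isT))).
  by split; [exists (vertex ord0)|exists (vertex (@Ordinal 3 1 isT))];
    try exact: gasket_vertex.
rewrite /= edist_tile edist_lam big_I3/= !lam_vertex/=.
by rewrite !subr0 sub0r expr0n/= addr0 sqrrN !expr1n -mulr2n mulVf// sqrtr1 mulr1.
Qed.

End Tiles.

(** * Energy and resistance *)

Lemma big_tupleS (T : finType) (A : Type) (idx : A) (op : Monoid.com_law idx)
    (n : nat) (F : seq T -> A) :
  \big[op/idx]_(w : n.+1.-tuple T) F w =
  \big[op/idx]_(i : T) \big[op/idx]_(w : n.-tuple T) F (i :: w).
Proof.
rewrite pair_big/= (reindex (fun p : T * n.-tuple T => cons_tuple p.1 p.2))//=.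
exists (fun w => (thead w, behead_tuple w)) => [[i w] _|w _] /=.
  by congr pair; exact: val_inj.
by rewrite [RHS]tuple_eta; exact: val_inj.
Qed.

Lemma big_tuple0 (T : finType) (A : Type) (idx : A) (op : Monoid.com_law idx)
    (F : seq T -> A) : \big[op/idx]_(w : 0.-tuple T) F w = F [::].
Proof.
rewrite (bigD1 [tuple])//= big1 ?Monoid.mulm1// => w.
by move=> /negP[]; apply/eqP/val_inj/size0nil; rewrite size_tuple.
Qed.

Section Energy.
Context {R : realType}.
Implicit Types (x y : R * R) (i j : 'I_3) (w v : seq 'I_3) (e : bool)
  (u : R * R -> R).

(** Recursion on the first letter replaces the sum over edges, so that statements on the energy
    become inductions whose base case is a single triangle. *)
Fixpoint cell_energy m u : R :=
  if m is m'.+1 then 5 / 3 * \sum_i cell_energy m' (u \o contraction i)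
  else 2^-1 * \sum_i \sum_j (u (vertex i) - u (vertex j)) ^+ 2.

Lemma cell_energyE m u : cell_energy m u = 2^-1 * (5 / 3) ^+ m *
  \sum_(w : m.-tuple 'I_3) \sum_i \sum_j
    (u (word_map w (vertex i)) - u (word_map w (vertex j))) ^+ 2.
Proof.
elim: m u => [|m IH] u /=.
  rewrite (@big_tuple0 _ _ _ _ (fun w : seq 'I_3 => \sum_i \sum_j
    (u (word_map w (vertex i)) - u (word_map w (vertex j))) ^+ 2))/=.
  by rewrite expr0 mulr1.
rewrite (@big_tupleS _ _ _ _ m (fun w : seq 'I_3 => \sum_i \sum_j
    (u (word_map w (vertex i)) - u (word_map w (vertex j))) ^+ 2))/=.
under eq_bigr do rewrite IH.
rewrite -mulr_sumr mulrA; congr (_ * _).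
by rewrite exprS; ring.
Qed.

(** Every edge belongs to exactly one cell, because two distinct cells of a level share at most one
    point; hence the indexing by words and pairs of vertices is injective. *)
Lemma energy_atE m u : energy_at m u = cell_energy m u.
Proof.
rewrite cell_energyE /energy_at; congr (_ * _).
pose h (z : m.-tuple 'I_3 * ('I_3 * 'I_3)) : (R * R) * (R * R) :=
  (word_map z.1 (vertex z.2.1), word_map z.1 (vertex z.2.2)).
rewrite (@reindex_fsbig _ _ _ _ _ h [set z | z.2.1 != z.2.2]); last first.
  split.
  - move=> [w [i j]]/= ij; split => /=.
      by move=> /word_map_inj/vertex_inj E; rewrite E eqxx in ij.
    by exists w; split; apply: imageP; exact: imageT.
  - move=> [w [i j]] [v [k l]] /set_mem/= ij /set_mem/= kl [E1 E2].
    have wv : w = v.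
      apply/val_inj/eqP; apply: contraT.
      have sz : size w = size v by rewrite !size_tuple.
      move=> /(word_map_meet (R := R) sz)[a aP].
      have := aP _ _ (triangle_vertex i) (triangle_vertex k) E1.
      rewrite -(aP _ _ (triangle_vertex j) (triangle_vertex l) E2).
      by move=> /vertex_inj E; rewrite E eqxx in ij.
    move: E1 E2; rewrite wv => /word_map_inj/vertex_inj-> /word_map_inj/vertex_inj->.
    by [].
  - move=> [x y] [/= xy [w [[_ [i _ <-] E1] [_ [j _ <-] E2]]]].
    exists (w, (i, j)) => /=; last by rewrite /h/= E1 E2.
    by apply/eqP => ij; apply: xy; rewrite -E1 -E2 ij.
under [RHS]eq_bigr do rewrite pair_big.
rewrite pair_big/= -(@bigfs _ _ _ _ (index_enum _) (fun z => z.2.1 != z.2.2))/=.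
- rewrite [RHS](bigID (fun z => z.2.1 != z.2.2))/= [X in _ = _ + X]big1 ?addr0//.
  by move=> [w [i j]] /= /negPn/eqP ->; rewrite subrr expr0n.
- exact: index_enum_uniq.
- by move=> z _; rewrite mem_index_enum.
Qed.

Lemma cell_energy_ge0 m u : 0 <= cell_energy m u.
Proof.
elim: m u => [|m IH] u /=; apply: mulr_ge0 => //; apply: sumr_ge0 => // i _.
by apply: sumr_ge0 => j _; exact: sqr_ge0.
Qed.

Lemma cell_energy01 u : cell_energy 0 u <= cell_energy 1 u.
Proof.
rewrite /= !big_I3/= !contraction_vertex.
rewrite !(contraction_vertexC (@Ordinal 3 1 isT) (@Ordinal 3 0 isT)).
rewrite !(contraction_vertexC (@Ordinal 3 2 isT) (@Ordinal 3 0 isT)).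
rewrite !(contraction_vertexC (@Ordinal 3 2 isT) (@Ordinal 3 1 isT)).
set a := u (vertex _); set b := u (vertex _); set c := u (vertex _).
set x := u (contraction _ _); set y := u (contraction _ _).
set z := u (contraction _ _).
(* Deviations from the values of the harmonic extension. *)
pose X := x - (2 * a + 2 * b + c) / 5; pose Y := y - (2 * a + b + 2 * c) / 5.
pose Z := z - (a + 2 * b + 2 * c) / 5.
rewrite -subr_ge0.
(* The cross terms between the deviations and a, b, c vanish because the harmonic extension
   minimises the energy; what remains is the energy of the deviations. *)
suff -> : forall p q, q = p + 5 / 3 * (2 * X ^+ 2 + 2 * Y ^+ 2 + 2 * Z ^+ 2 +
    (X - Y) ^+ 2 + (X - Z) ^+ 2 + (Y - Z) ^+ 2) -> 0 <= q - p.
- by [].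
- by rewrite /X /Y /Z; field.
move=> p q ->; rewrite addrAC subrr add0r mulr_ge0//.
by rewrite !addr_ge0// ?sqr_ge0// mulr_ge0// sqr_ge0.
Qed.

Lemma cell_energy_nd u : {homo (fun m => cell_energy m u) : m n / (m <= n)%N >-> m <= n}.
Proof.
apply: homo_leq => [//|? ? ?|m]; first exact: le_trans.
elim: m u => [|m IH] u; first exact: cell_energy01.
by rewrite [leLHS]/= [leRHS]/= ler_pM2l//; apply: ler_sum => i _; exact: IH.
Qed.

Lemma energy_cvg u : (cell_energy m u)%:E @[m --> \oo] --> energy u.
Proof.
have -> : energy u = limn (fun m => (cell_energy m u)%:E).
  by rewrite /energy; under eq_fun do rewrite energy_atE.
apply: ereal_nondecreasing_is_cvgn => m n mn; rewrite lee_fin.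
exact: cell_energy_nd.
Qed.

Lemma energy_ge m u : ((cell_energy m u)%:E <= energy u)%E.
Proof.
rewrite -(cvg_lim _ (@energy_cvg u))//; apply: lime_ge.
  by apply/cvg_ex; exists (energy u); exact: energy_cvg.
by exists m => // n mn; rewrite lee_fin; exact: cell_energy_nd.
Qed.

Lemma energy_ge0 u : (0 <= energy u)%E.
Proof.
by apply: le_trans (energy_ge 0 u); rewrite lee_fin cell_energy_ge0.
Qed.

Lemma energy_le u c : (forall m, ((cell_energy m u)%:E <= c)%E) -> (energy u <= c)%E.
Proof.
move=> h; rewrite -(cvg_lim _ (@energy_cvg u))//; apply: lime_le.
  by apply/cvg_ex; exists (energy u); exact: energy_cvg.
exact: nearW.
Qed.

Lemma energy_split u :
  energy u = ((5 / 3)%:E * \sum_i energy (u \o contraction i))%E.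
Proof.
rewrite -(cvg_lim _ (@energy_cvg u))//; apply/cvg_lim => //.
rewrite -(cvg_shiftS (fun m => (cell_energy m u)%:E)) /=.
under eq_fun do rewrite EFinM -sumEFin.
apply: cvgeZl => //; apply: cvg_nnesum => i _; last exact: energy_cvg.
by apply: nearW => m; rewrite lee_fin cell_energy_ge0.
Qed.

Lemma energy_words n u : energy u =
  (((5 / 3) ^+ n)%:E * \sum_(w : n.-tuple 'I_3) energy (u \o word_map w))%E.
Proof.
elim: n u => [|n IH] u.
  rewrite (@big_tuple0 _ _ _ _ (fun w : seq 'I_3 => energy (u \o word_map w)))/=.
  by rewrite expr0 mul1e.
rewrite (@big_tupleS _ _ _ _ n (fun w : seq 'I_3 => energy (u \o word_map w)))/=.
rewrite energy_split [X in (_ * X)%E = _](eq_bigr _ (fun i _ => IH (u \o contraction i))).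
rewrite -ge0_sume_distrr; last first.
  by move=> i _; apply: sume_ge0 => w _; exact: energy_ge0.
by rewrite muleA -EFinM -exprS.
Qed.

(* Effective resistances: the vertices of a word of length k are joined to the
   boundary by a chain with one edge per level, and (3/5)^(k/2) <= (4/5)^k. *)
Lemma cell_energy_osc m u x i : V m x ->
  `|u x - u (vertex i)| <= 5 * Num.sqrt (cell_energy m u).
Proof.
have E0 (v : R * R -> R) k l : `|v (vertex k) - v (vertex l)| <= Num.sqrt (cell_energy 0 v).
  rewrite -sqrtr_sqr ler_sqrt ?cell_energy_ge0//= !big_I3/=.
  set a := v (vertex (@Ordinal 3 0 isT)); set b := v (vertex (@Ordinal 3 1 isT)).
  set c := v (vertex (@Ordinal 3 2 isT)).
  have := (sqr_ge0 (a - b), sqr_ge0 (a - c), sqr_ge0 (b - c)).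
  by elim/I3P: k; elim/I3P: l; rewrite -/a -/b -/c => -[[h1 h2] h3]; nra.
elim: m u x i => [|m IH] u x i.
  by move=> [k _ <-]; apply: le_trans (E0 _ _ _) _; rewrite ler_peMl ?sqrtr_ge0// ler1n.
move=> [j _ [y Vy <-]]; have := IH (u \o contraction j) y j Vy.
rewrite /= contraction_vertex.
set e := cell_energy m _; set E := 5 / 3 * _.
have eE : e <= 3 / 5 * E.
  rewrite /E mulrA (_ : 3 / 5 * (5 / 3) = 1) ?mul1r; last by lra.
  by rewrite (bigD1 j)//= lerDl; apply: sumr_ge0 => k _; exact: cell_energy_ge0.
have E_ge0 : 0 <= E by exact: (cell_energy_ge0 m.+1 u).
have e1 : Num.sqrt e <= 4 / 5 * Num.sqrt E.
  rewrite (_ : 4 / 5 = Num.sqrt ((4 / 5) ^+ 2)); last by rewrite sqrtr_sqr ger0_norm.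
  rewrite -sqrtrM ?sqr_ge0// ler_sqrt; first by apply: le_trans eE _; nra.
  by rewrite mulr_ge0// sqr_ge0.
have e2 : `|u (vertex j) - u (vertex i)| <= Num.sqrt E.
  apply: le_trans (E0 u j i) _; rewrite ler_sqrt//.
  exact: (@cell_energy_nd u 0 m.+1).
(* The constant 5 is the fixed point of the recursion: 5 * (4 / 5) + 1 = 5. *)
move=> e3; rewrite -(subrKA (u (vertex j))); apply: le_trans (ler_normD _ _) _; lra.
Qed.

(** Both points are compared with [vertex ord0], whence 10 = 5 + 5. Continuity is assumed only as
    approximation of values by values at vertices, the form in which it is available for
    [u \o tile e K w]. *)
Lemma energy_osc u x y : (energy u < +oo)%E -> gasket x -> gasket y ->
  (forall z, gasket z -> forall eps, 0 < eps ->
     exists m z', V m z' /\ `|u z - u z'| < eps) ->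
  `|u x - u y| <= 10 * Num.sqrt (fine (energy u)).
Proof.
move=> Efin Gx Gy cu; have Ef : energy u \is a fin_num.
  by rewrite ge0_fin_numE ?energy_ge0.
suff h z : gasket z -> `|u z - u (vertex ord0)| <= 5 * Num.sqrt (fine (energy u)).
  rewrite -(subrKA (u (vertex ord0))); apply: le_trans (ler_normD _ _) _.
  rewrite (distrC _ (u y)); have := h _ Gx; have := h _ Gy; lra.
move=> Gz; apply/ler_addgt0Pr => eps eps0.
have [m [z' [Vz' zz']]] := cu _ Gz _ eps0.
rewrite -(subrKA (u z')); apply: le_trans (ler_normD _ _) _; rewrite addrC lerD//; last exact: ltW.
apply: le_trans (cell_energy_osc _ _ Vz') _; rewrite ler_pM2l// ler_sqrt.
  by rewrite -lee_fin fineK// energy_ge.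
by rewrite fine_ge0// energy_ge0.
Qed.

End Energy.

Lemma fsbigT_fin (T : finType) (A : Type) (idx : A) (op : Monoid.com_law idx)
  (F : T -> A) : \big[op/idx]_(i \in [set: T]) F i = \big[op/idx]_(i : T) F i.
Proof.
have -> : [set: T] = [set` (predT : {pred T})] by apply/seteqP; split.
rewrite -(@bigfs _ _ _ _ (index_enum T) predT)//; last first.
  by move=> i _; rewrite mem_index_enum.
exact: index_enum_uniq.
Qed.

(** * Energy on the infinite gasket *)

Section HEnergy.
Context {R : realType}.
Implicit Types (x y : R * R) (i j : 'I_3) (w v : seq 'I_3) (e : bool)
  (u : R * R -> R).

(** The scale K and the depth n are independent: K determines the region and K - n the size of the
    cells. For n = K the summands are terms of [henergy]. *)
Definition tile_energy (K n : nat) u : \bar R :=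
  (\sum_(e : bool) \sum_(w : n.-tuple 'I_3) energy (u \o tile e K w))%E.

Lemma tile_energyE K n u :
  tile_energy K n u = (((3 / 5) ^+ n)%:E * tile_energy K 0 u)%E.
Proof.
rewrite /tile_energy ge0_sume_distrr; last first.
  by move=> e _; apply: sume_ge0 => w _; exact: energy_ge0.
apply: eq_bigr => e _.
rewrite (@big_tuple0 _ _ _ _ (fun w : seq 'I_3 => energy (u \o tile e K w))).
rewrite (energy_words n) muleA -EFinM -exprMn.
rewrite (_ : 3 / 5 * (5 / 3) = 1); last by lra.
by rewrite expr1n mul1e; apply: eq_bigr => w _; congr energy.
Qed.

Let range_tile (K : nat) : set (R * R -> R * R) :=
  range (fun z : bool * K.-tuple 'I_3 => tile z.1 K z.2).

Let fsum_range_tile (K : nat) (a : (R * R -> R * R) -> \bar R) :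
  (\sum_(t \in range_tile K) a t =
   \sum_(e : bool) \sum_(w : K.-tuple 'I_3) a (tile e K w))%E.
Proof.
rewrite (@reindex_fsbig _ _ _ _ _
  (fun z : bool * K.-tuple 'I_3 => tile z.1 K z.2 : R * R -> R * R) setT).
  by rewrite fsbigT_fin pair_big.
split => //; first by move=> z _; exact: imageT.
move=> [e w] [e' v] _ _ /= /tile_inj.
by rewrite !size_tuple => /(_ erefl)[-> /val_inj ->].
Qed.

Let finite_range_tile K : finite_set (range_tile K).
Proof. by apply: finite_image; exact: finite_finset. Qed.

Lemma tile_energy_henergy K u : (tile_energy K K u <= henergy u)%E.
Proof.
apply: esum_ge; exists (range_tile K); last by rewrite fsum_range_tile.
split; first exact: finite_range_tile.
move=> _ [[e w] _ <-] /=.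
by have := @tile_tile_maps R e w; rewrite size_tuple.
Qed.

(** The factor is s^(1/delta_s) for s = 3^(K - n), as [energy_scale_expR] makes explicit. *)
Lemma tile_energy_le K n u :
  (tile_energy K n u <= ((5 / 3) ^+ K * (3 / 5) ^+ n)%:E * henergy u)%E.
Proof.
have -> : tile_energy K n u = (((5 / 3) ^+ K * (3 / 5) ^+ n)%:E * tile_energy K K u)%E.
  rewrite (tile_energyE K n) (tile_energyE K K) muleA -EFinM; congr (_%:E * _)%E.
  by rewrite mulrAC -exprMn (_ : 5 / 3 * (3 / 5) = 1) ?expr1n ?mul1r//; lra.
apply: lee_wpmul2l; last exact: tile_energy_henergy.
by rewrite lee_fin mulr_ge0// exprn_ge0.
Qed.

(** Padding brings any finite set of tiles to one common scale K, which may be taken as large as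
    desired. *)
Lemma henergy_le K0 c u :
  (forall K, (K0 <= K)%N -> (tile_energy K K u <= c)%E) -> (henergy u <= c)%E.
Proof.
move=> h; apply: ge_ereal_sup => _ [A [finA At] <-].
have /choice[kf kfP] : forall t : R * R -> R * R, exists k, tile_maps t ->
    forall K, (k <= K)%N -> exists e w, size w = K /\ t = tile e K w.
  move=> t; have [/tile_maps_pad[k kP]|nt] := pselect (tile_maps t); first by exists k.
  by exists 0%N.
pose K := maxn K0 (\max_(t <- fset_set A) kf t)%N.
have AK : A `<=` range_tile K.
  move=> t tA; have [] := kfP t (At _ tA) K.
    rewrite leq_max; apply/orP; right.
    by apply: leq_bigmax_seq => //; rewrite in_fset_set//; exact: mem_set.
  by move=> e [w [sw ->]]; exists (e, tcast sw (in_tuple w)); rewrite //= val_tcast.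
apply: (@le_trans _ _ (\sum_(t \in range_tile K) energy (u \o t))%E); last first.
  by rewrite fsum_range_tile; apply: h; exact: leq_maxl.
apply: lee_fsum_nneg_subset => //.
- exact/subsetP.
- by move=> t _; exact: energy_ge0.
Qed.

Lemma henergy_ge0 u : (0 <= henergy u)%E.
Proof. by apply: esum_ge0 => t _; exact: energy_ge0. Qed.

End HEnergy.

(** * The Hausdorff measure *)

Lemma measure_mono d (T : measurableType d) (R : realType)
    (mu : {measure set T -> \bar R}) (A B : set T) :
  measurable A -> measurable B -> A `<=` B -> (mu A <= mu B)%E.
Proof. by move=> mA mB; apply: le_measure; exact: mem_set. Qed.

Section FiniteFamilies.
Context d (T : measurableType d) (R : realType)
  (mu : {measure set T -> \bar R}) (I : finType) (F : I -> set T).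
Hypothesis mF : forall i, measurable (F i).

Lemma integral_le_cover (D : set T) (f : T -> \bar R) (c : I -> R) :
  measurable D -> measurable_fun D f -> (forall x, 0 <= f x)%E ->
  (forall i, 0 <= c i) ->
  (forall x, D x -> exists i, F i x /\ (f x <= (c i)%:E)%E) ->
  (\int[mu]_(x in D) f x <= \sum_i (c i)%:E * mu (F i))%E.
Proof.
move=> mD mf f0 c0 cover.
pose g i x : \bar R := ((c i)%:E * (\1_(F i) x)%:E)%E.
have g0 i x : (0 <= g i x)%E by rewrite mule_ge0// lee_fin.
have mg i A : measurable_fun A (g i).
  by apply: measurable_funeM; apply/measurable_EFinP; exact: measurable_indic.
apply: (@le_trans _ _ (\int[mu]_(x in D) \sum_i g i x)%E).
  apply: ge0_le_integral => //.
  - by apply: emeasurable_sum => i; exact: mg.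
  - move=> x /cover[i [Fix fc]]; apply: le_trans fc _.
    rewrite (bigD1 i)//= /g indicE mem_set//= mule1.
    by rewrite leeDl// sume_ge0// => j _; exact: g0.
rewrite ge0_integral_sum//; apply: lee_sum => i _; rewrite ge0_integralZl//=.
- apply: lee_wpmul2l; first by rewrite lee_fin.
  rewrite integral_indic//; apply: measure_mono => //; exact: measurableI.
- by apply/measurable_EFinP; exact: measurable_indic.
- by rewrite lee_fin.
Qed.

(** Removing the null set N makes the family disjoint without changing the integrals. *)
Lemma sum_integral_le (N : set T) (f : T -> \bar R) :
  measurable N -> mu N = 0%E -> (forall i j, i != j -> F i `&` F j `<=` N) ->
  measurable_fun setT f -> (forall x, 0 <= f x)%E ->
  (\sum_i \int[mu]_(x in F i) f x <= \int[mu]_x f x)%E.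
Proof.
move=> mN N0 FN mf f0.
have mfA A : measurable_fun A f by exact: measurable_funTS.
have -> : (\sum_i \int[mu]_(x in F i) f x =
           \sum_i \int[mu]_(x in F i `\` N) f x)%E.
  by apply: eq_bigr => i _; exact: ge0_negligible_integral.
have mFN i : measurable (F i `\` N) by exact: measurableD.
rewrite -ge0_integral_bigsetU//.
- apply: ge0_subset_integral => //.
  by apply: bigsetU_measurable.
- exact: index_enum_uniq.
- apply/trivIsetP => i j _ _ ij; apply/seteqP; split => // x [[Fi nN] [Fj _]].
  by apply: nN; apply: (FN _ _ ij).
Qed.

Lemma measure_le_cover (D : set T) : measurable D -> D `<=` \bigcup_i F i ->
  (mu D <= \sum_i mu (F i))%E.
Proof.
move=> mD DF; have := @integral_le_cover D (cst 1%E) (cst 1) mD.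
rewrite integral_cst// mul1e => h; apply: le_trans (h _ _ _ _) _ => //.
- by move=> x /DF[i _ Fix]; exists i; split.
- by under eq_bigr do rewrite mul1e.
Qed.

Lemma sum_measure_le (N D : set T) : measurable D ->
  measurable N -> mu N = 0%E -> (forall i j, i != j -> F i `&` F j `<=` N) ->
  (forall i, F i `<=` D) -> (\sum_i mu (F i) <= mu D)%E.
Proof.
move=> mD mN N0 FN FD.
have := @sum_integral_le N (fun x => (\1_D x)%:E) mN N0 FN.
rewrite integral_indic// setIT => h; apply: le_trans (h _ _) => //.
- apply: lee_sum => i _; rewrite integral_indic//.
  by rewrite setIidr//; exact: FD.
- by apply/measurable_EFinP; exact: measurable_indic.
Qed.

End FiniteFamilies.

(** The measurable sets of [R * R] form the product sigma-algebra, so topology enters through a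
    countable base of rational rectangles. *)
Lemma plane_open_measurable (R : realType) (U : set (R * R)) :
  open U -> measurable U.
Proof.
move=> oU.
pose B (z : (rat * rat) * (rat * rat)) : set (R * R) :=
  `]ratr z.1.1, ratr z.1.2[%classic `*` `]ratr z.2.1, ratr z.2.2[%classic.
have -> : U = \bigcup_z (if `[< B z `<=` U >] then B z else set0).
  apply/seteqP; split => x; last first.
    by move=> [z _]; case: asboolP => // BU; exact: BU.
  move=> Ux; have := oU x Ux => /nbhs_ballP[e /= e0 xeU].
  have rt (t : R) : exists p : rat * rat, (t \in `]ratr p.1, ratr p.2[) /\
      `]ratr p.1, ratr p.2[%classic `<=` ball t e.
    have [a] := @rat_in_itvoo R (t - e) t ltac:(lra).
    have [b] := @rat_in_itvoo R t (t + e) ltac:(lra).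
    rewrite !in_itv/= => /andP[tent01 be] /andP[ea at_]; exists (a, b); split => /=.
      by rewrite in_itv/= at_ tent01.
    move=> s /=; rewrite in_itv/= -ball_normE/= => /andP[a_s sb].
    by rewrite ltr_norml; apply/andP; split; lra.
  have [p [xp pB]] := rt x.1; have [q [xq qB]] := rt x.2.
  exists (p, q) => //; case: asboolP => [_|[]]; first by split.
  by move=> y [yp yq]; apply: xeU; split; [exact: pB|exact: qB].
apply: countable_bigcupT_measurable => [|z]; first exact: countableP.
by case: ifP => // _; apply: measurableX; exact: measurable_itv.
Qed.

Lemma plane_closed_measurable (R : realType) (A : set (R * R)) :
  closed A -> measurable A.
Proof.
by move=> cA; rewrite -(setCK A); apply: measurableC; apply: plane_open_measurable; rewrite openC.
Qed.

Lemma plane_measurable_set1 (R : realType) (x : R * R) : measurable [set x].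
Proof.
apply: plane_closed_measurable; apply: accessible_closed_set1.
by apply: hausdorff_accessible; exact: norm_hausdorff.
Qed.

(** * Measures of cells *)

Section GasketMeasure.
Context {R : realType}.
Implicit Types (x y : R * R) (i j : 'I_3) (w v : seq 'I_3) (e : bool)
  (u : R * R -> R).

Lemma measurable_cell e k w : measurable (@cell R e k w).
Proof. by apply: plane_closed_measurable; exact: closed_cell. Qed.

Lemma measurable_exhaustion a : measurable (@exhaustion R a).
Proof. by apply: measurableU; exact: measurable_cell. Qed.

Lemma measurable_hgasket : measurable (@hgasket R).
Proof.
rewrite hgasket_exhaustion; apply: bigcupT_measurable => a; exact: measurable_exhaustion.
Qed.

Lemma measurable_hgasket_fun u : {within hgasket, continuous u} ->
  measurable_fun setT (u \_ hgasket).
Proof.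
move=> cu; apply/(measurable_restrictT u measurable_hgasket).
move/continuousP : cu => cu.
apply: (measurability _ (RGenOpens.measurableE R)) => _ [_ [a [b ->] <-]].
have oab : open (`]a, b[%classic : set R) by exact: interval_open.
have /open_subspaceP[V oV eV] := cu _ oab.
rewrite setIC -eV; apply: measurableI; first exact: plane_open_measurable.
exact: measurable_hgasket.
Qed.

Variables (nu : probability (R * R)%type R)
  (hnu : {measure set (R * R)%type -> \bar R}).
Hypotheses (nuP : is_gasket_measure nu) (hnuP : is_hgasket_measure nu hnu).

Lemma gasket_measure_point x : gasket x -> nu [set x] = 0%E.
Proof.
move=> Gx; apply/eqP; rewrite eq_le measure_ge0 andbT.
apply/lee_addgt0Pr => eps eps0; rewrite add0e.
have [n] : exists n, (3^-1 : R) ^+ n < eps.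
  have := @cvg_expr R 3^-1; rewrite ger0_norm// => /(_ ltac:(lra)).
  move=> /cvgrPdist_lt/(_ _ eps0)[n _ h]; exists n.
  by have := h n (leqnn n); rewrite sub0r normrN ger0_norm// exprn_ge0.
have [w [y [<- Gy xE]]] := gasket_word_split n Gx.
move=> lt_eps; apply: le_trans (_ : ((3^-1 ^+ size w)%:E <= _)%E); last first.
  by rewrite lee_fin ltW.
rewrite -nuP; apply: measure_mono.
- by exact: plane_measurable_set1.
- have := @measurable_cell false 0%N w; congr measurable; apply: eq_imagel => z _.
  by rewrite /tile expr0 mul1r scale1.
- by move=> _ ->; exists y.
Qed.

Lemma hgasket_measure_point x : hgasket x -> hnu [set x] = 0%E.
Proof.
move=> /hgasketP[e [k cx]]; have [v [sv [y Gy <-]]] := cell_split k cx.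
rewrite -(gasket_measure_point Gy) -(hnuP.2 (tile e k v)).
- by rewrite image_set1.
- by rewrite -sv; exact: tile_tile_maps.
- by exact: plane_measurable_set1.
- by move=> _ ->.
Qed.

(** Distinct cells of one level overlap only inside this finite set, which is null for [hnu]. *)
Definition cell_vertices (K n : nat) : set (R * R) :=
  \bigcup_(z in [set: bool * n.-tuple 'I_3 * 'I_3])
    [set tile z.1.1 K z.1.2 (vertex z.2)].

Lemma measurable_cell_vertices K n : measurable (cell_vertices K n).
Proof.
apply: fin_bigcup_measurable; first exact: finite_finset.
by move=> z _; exact: plane_measurable_set1.
Qed.

Lemma measure_cell_vertices K n : hnu (cell_vertices K n) = 0%E.
Proof.
apply/eqP; rewrite eq_le measure_ge0 andbT.
have := @measure_le_cover _ _ _ hnu (bool * n.-tuple 'I_3 * 'I_3)%type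
  (fun z => [set tile z.1.1 K z.1.2 (vertex z.2)]).
move=> /(_ _ (cell_vertices K n)) h; apply: le_trans (h _ _ _) _ => //.
- by move=> z; exact: plane_measurable_set1.
- exact: measurable_cell_vertices.
- rewrite big1// => z _; apply: hgasket_measure_point; apply: tile_hgasket.
  exact: gasket_vertex.
Qed.

Lemma cellI_vertices K n e e' (w v : n.-tuple 'I_3) : (e, w) != (e', v) ->
  cell e K w `&` cell e' K v `<=` cell_vertices K n.
Proof.
move=> ne x [[y Gy <-] [z Gz E]].
have [||i iP] := @tile_meet R e e' K w v; first by rewrite !size_tuple.
  by apply: contra ne; rewrite !xpair_eqE.
exists ((e, w), i) => //=; rewrite (iP y z)//; exact: gasket_triangle.
Qed.

(** A word of length at least K names a subcell of a tile, measured by [nu]. A shorter one names a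
    union of 3^(K - size w) tiles of measure 1 with null overlaps. *)
Lemma measure_cell e K w : hnu (cell e K w) = (3 ^+ K / 3 ^+ size w)%:E.
Proof.
have [Kw|wK] := leqP K (size w).
  have sw : size (take K w) = K by rewrite size_take_min; apply/minn_idPl.
  have -> : @cell R e K w = tile e K (take K w) @` (word_map (drop K w) @` gasket).
    rewrite image_comp; apply: eq_imagel => x _ /=.
    by rewrite -tile_cat cat_take_drop.
  rewrite hnuP.2.
  - rewrite nuP size_drop -[in LHS](subnK Kw).
    rewrite -[in RHS](subnKC Kw) exprD invfM mulrA mulfV ?expf_neq0 ?pnatr_eq0//.
    by rewrite mul1r exprVn addnK.
  - by have := @tile_tile_maps R e (take K w); rewrite sw.
  - have := @measurable_cell false 0%N (drop K w); congr measurable; apply: eq_imagel => z _.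
    by rewrite /tile expr0 mul1r scale1.
  - by move=> _ [x Gx <-]; exact: gasket_word_map.
pose d := (K - size w)%N; pose F (v : d.-tuple 'I_3) := @cell R e K (w ++ v).
have mF (v : d.-tuple 'I_3) : measurable (F v) by exact: measurable_cell.
have hF (v : d.-tuple 'I_3) : hnu (F v) = 1%E.
  have sv : size (w ++ v) = K by rewrite size_cat size_tuple subnKC// ltnW.
  rewrite /F /cell hnuP.2.
  - by rewrite -(expr0 3^-1) -(nuP [::]) image_id.
  - by have := @tile_tile_maps R e (w ++ v); rewrite sv.
  - by apply: plane_closed_measurable; exact: closed_gasket.
  - by [].
transitivity (\sum_(v : d.-tuple 'I_3) hnu (F v))%E.
  apply/eqP; rewrite eq_le; apply/andP; split.
    apply: measure_le_cover => //; first exact: measurable_cell.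
    move=> x /(cell_split d)[v [sv cx]].
    by exists (tcast sv (in_tuple v)) => //; rewrite /F val_tcast.
  apply: (@sum_measure_le _ _ _ hnu _ F mF (cell_vertices K (size w + d))).
  - exact: measurable_cell.
  - exact: measurable_cell_vertices.
  - exact: measure_cell_vertices.
  - move=> v v' vv'.
    have := @cellI_vertices K _ e e (cat_tuple (in_tuple w) v) (cat_tuple (in_tuple w) v'); apply.
    rewrite xpair_eqE eqxx/= -val_eqE/= eqseq_cat// eqxx/=.
    by apply: contra vv' => /eqP/val_inj ->.
  - by move=> v _ [y Gy <-]; exists (word_map v y); rewrite ?tile_cat//; exact: gasket_word_map.
under eq_bigr do rewrite hF.
rewrite sumEFin sumr_const card_tuple card_ord; congr EFin.
rewrite -[in RHS](subnK (ltnW wK)) exprD mulfK ?expf_neq0 ?pnatr_eq0//.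
by rewrite -natrX.
Qed.

Lemma sum_cells_integral_le K n (f : R * R -> \bar R) :
  measurable_fun setT f -> (forall x, 0 <= f x)%E ->
  (\sum_(z : bool * n.-tuple 'I_3) \int[hnu]_(x in cell z.1 K z.2) f x
     <= \int[hnu]_x f x)%E.
Proof.
move=> mf f0; apply: (@sum_integral_le _ _ _ hnu _ _ _ (cell_vertices K n)) => //.
- by move=> z; exact: measurable_cell.
- exact: measurable_cell_vertices.
- exact: measure_cell_vertices.
- by move=> [e w] [e' v] /cellI_vertices.
Qed.

(** Monotone convergence along the exhaustion; thanks to it all sums over cells can be finite. *)
Lemma integral_hgasket_le (mu : {measure set (R * R)%type -> \bar R})
    (f : R * R -> \bar R) K0 c :
  measurable_fun hgasket f -> (forall x, 0 <= f x)%E ->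
  (forall K, (K0 <= K)%N -> (\int[mu]_(x in exhaustion K) f x <= c)%E) ->
  (\int[mu]_(x in hgasket) f x <= c)%E.
Proof.
move=> mf f0 h; have mB a : measurable_fun (exhaustion a) f.
  apply: measurable_funS mf; first exact: measurable_hgasket.
  by rewrite hgasket_exhaustion => x Bx; exists a.
have ndB : nondecreasing_seq (@exhaustion R).
  by move=> a b ab; apply/subsetPset; exact: exhaustion_mono.
have := @ge0_nondecreasing_set_cvg_integral _ _ R (@exhaustion R) f mu ndB
  measurable_exhaustion mB (fun _ x _ => f0 x).
rewrite -hgasket_exhaustion => cv; apply: (cvge_le _ cv).
by exists K0 => // K /=; exact: h.
Qed.

End GasketMeasure.

(** * The estimate at a fixed level *)

Section LevelBound.
Context {R : realType}.
Implicit Types (x y : R * R) (w v : seq 'I_3) (e : bool)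
  (u : R * R -> R).

Lemma rinvE (r : R) : 0 < r -> rinv r%:E = r^-1.
Proof. by move=> r0; rewrite /rinv inver gt_eqF. Qed.

Lemma rinvy : rinv (+oo%E : \bar R) = 0.
Proof. by rewrite /rinv invey. Qed.

Lemma within_continuousP (A : set (R * R)) u : {within A, continuous u} <->
  (forall x, A x -> forall eps, 0 < eps ->
     \forall y \near x, A y -> `|u x - u y| < eps).
Proof.
rewrite subspace_continuousP; split=> [h x Ax eps e0|h x Ax].
  by have /cvgrPdist_lt/(_ _ e0) := h x Ax.
by apply/cvgrPdist_lt => eps e0; exact: h.
Qed.

Lemma cell_osc u e K w x y : {within hgasket, continuous u} ->
  (energy (u \o tile e K w) < +oo)%E -> cell e K w x -> cell e K w y ->
  `|u x - u y| <= 10 * Num.sqrt (fine (energy (u \o tile e K w))).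
Proof.
move=> /within_continuousP cu Efin [x' Gx <-] [y' Gy <-].
apply: (@energy_osc _ (u \o tile e K w)) => // z Gz eps e0.
have h := cu _ (tile_hgasket e K w Gz) _ e0.
have := Gz _ (@tile_continuous _ e K w z _ h) => -[z' [[m _ Vz'] /= hz']].
exists m, z'; split => //; apply: hz'; apply: tile_hgasket.
by apply: subset_closure; exists m.
Qed.

Lemma cell_nonempty e K w : (@cell R e K w) !=set0.
Proof. by exists (tile e K w (vertex ord0)), (vertex ord0) => //; exact: gasket_vertex. Qed.

Lemma cell_inf u e K w : {within hgasket, continuous u} ->
  (energy (u \o tile e K w) < +oo)%E -> exists a : R, [/\ 0 <= a,
    forall x, cell e K w x -> a <= `|u x| &
    forall x, cell e K w x ->
      `|u x| <= a + 10 * Num.sqrt (fine (energy (u \o tile e K w)))].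
Proof.
move=> cu Efin; pose B := [set `|u x| | x in cell e K w].
have B0 : B !=set0 by have [x cx] := cell_nonempty e K w; exists `|u x|, x.
have lB : has_lbound B by exists 0 => _ [x _ <-].
exists (inf B); split.
- by apply: lb_le_inf => // _ [x _ <-].
- by move=> x cx; apply: ge_inf => //; exists x.
- move=> x cx; rewrite -lerBlDr; apply: lb_le_inf => // _ [y cy <-].
  rewrite lerBlDl -lerBlDr.
  by apply: le_trans (cell_osc cu Efin cx cy); rewrite lerB_dist.
Qed.

Variables (nu : probability (R * R)%type R)
  (hnu : {measure set (R * R)%type -> \bar R}).
Hypotheses (nuP : is_gasket_measure nu) (hnuP : is_hgasket_measure nu hnu).

Lemma measurable_powRfun (r : R) u : {within hgasket, continuous u} ->
  measurable_fun setT (fun x => (`|(u \_ hgasket) x| `^ r)%:E).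
Proof.
move=> cu; apply/measurable_EFinP.
apply: (measurableT_comp (measurable_powR r)).
by apply: measurableT_comp => //; exact: measurable_hgasket_fun.
Qed.

Lemma hLnormE (mu : {measure set (R * R)%type -> \bar R}) (r : R) u :
  hLnorm mu r%:E u = ((\int[mu]_x (`|(u \_ hgasket) x| `^ r)%:E) `^ r^-1)%E.
Proof. by rewrite /hLnorm unlock. Qed.

Lemma hLnorm_le (mu : {measure set (R * R)%type -> \bar R}) (r A : R) u :
  0 < r -> 0 <= A -> (hLnorm mu r%:E u <= A%:E)%E <->
  (\int[mu]_x (`|(u \_ hgasket) x| `^ r)%:E <= (A `^ r)%:E)%E.
Proof.
move=> r0 A0; rewrite hLnormE.
set I := (\int[mu]_x _)%E.
have I0 : (0 <= I)%E by apply: integral_ge0 => x _; rewrite lee_fin powR_ge0.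
have AE : A = (A `^ r) `^ r^-1.
  by rewrite -powRrM mulfV ?gt_eqF// powRr1.
split=> h.
  have IE : I = ((I `^ r^-1) `^ r)%E.
    by rewrite -poweRrM mulVf ?gt_eqF// poweRe1.
  rewrite IE -poweR_EFin; apply: gt0_ler_poweR; rewrite ?in_itv/= ?leey ?andbT//.
  - exact: ltW.
  - exact: poweR_ge0.
rewrite [in leRHS]AE -poweR_EFin; apply: gt0_ler_poweR; rewrite ?in_itv/= ?leey ?andbT//.
- by rewrite invr_ge0 ltW.
- by rewrite lee_fin powR_ge0.
Qed.

Lemma Lp_sum (r A : R) u K n (a : bool * n.-tuple 'I_3 -> R) :
  {within hgasket, continuous u} -> 0 < r -> 0 <= A ->
  (hLnorm hnu r%:E u <= A%:E)%E -> (forall z, 0 <= a z) ->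
  (forall (z : bool * n.-tuple 'I_3) x, cell z.1 K z.2 x -> a z <= `|u x|) ->
  \sum_z (a z) `^ r * (3 ^+ K / 3 ^+ n) <= A `^ r.
Proof.
move=> cu r0 A0 /(hLnorm_le _ _ r0 A0) uA a0 au.
rewrite -lee_fin -sumEFin; apply: le_trans _ uA.
have mf := measurable_powRfun r cu.
apply: le_trans _ (sum_cells_integral_le nuP hnuP K n mf _); last first.
  by move=> x; rewrite lee_fin powR_ge0.
apply: lee_sum => z _.
rewrite EFinM; have := measure_cell nuP hnuP z.1 K z.2.
rewrite size_tuple => <-; rewrite -integral_cst; last exact: measurable_cell.
apply: ge0_le_integral => //.
- exact: measurable_cell.
- by move=> x _; rewrite lee_fin powR_ge0.
- exact: measurable_funTS.
- move=> x cx; rewrite lee_fin /patch mem_set; last exact: cell_hgasket cx.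
  by rewrite ge0_ler_powR ?nnegrE ?a0 ?normr_ge0 ?(ltW r0)// au.
Qed.

Lemma cell_scale_gt0 K n : 0 < 3 ^+ K / 3 ^+ n :> R.
Proof. by rewrite divr_gt0 ?exprn_gt0. Qed.

(** For finite p all terms of [Lp_sum] but one are set to 0. For p = oo the cell has positive
    measure, so it cannot lie in the exceptional null set. Both cases share one formula because
    [rinv +oo] is 0. *)
Lemma Lp_single (p : \bar R) (A a : R) u e K w :
  {within hgasket, continuous u} -> (1 <= p)%E -> 0 <= A ->
  (hLnorm hnu p u <= A%:E)%E -> 0 <= a ->
  (forall x, cell e K w x -> a <= `|u x|) ->
  a <= A * (3 ^+ K / 3 ^+ size w) `^ (- rinv p).
Proof.
move=> cu p1 A0 uA a0 au; case: p p1 uA => [r||]//= p1 uA; last first.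
  rewrite rinvy oppr0 powRr0 mulr1 leNgt; apply/negP => Aa.
  have c0 : (0 < hnu (cell e K w))%E by rewrite (measure_cell nuP hnuP) lte_fin cell_scale_gt0.
  have T0 : (0 < hnu setT)%E.
    apply: lt_le_trans c0 _; apply: measure_mono => //; exact: measurable_cell.
  move: uA; rewrite /hLnorm unlock T0 => /ess_supP[N [mN N0 sN]].
  suff : (hnu (cell e K w) <= 0)%E by rewrite leNgt c0.
  rewrite -N0; apply: measure_mono => //; first exact: measurable_cell.
  move=> x cx; apply: sN => /=; rewrite /patch mem_set; last exact: cell_hgasket cx.
  by apply/negP; rewrite -ltNge lte_fin; apply: lt_le_trans Aa _; exact: au.
have r0 : 0 < r by rewrite (@lt_le_trans _ _ 1)// -lee_fin.
rewrite rinvE//; set s := _ / _.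
have s0 : 0 < s by exact: cell_scale_gt0.
pose b (z : bool * (size w).-tuple 'I_3) := if z == (e, in_tuple w) then a else 0.
have := @Lp_sum r A u K (size w) b cu r0 A0 uA.
rewrite (bigD1 (e, in_tuple w))//= big1 ?addr0; last first.
  by move=> z zw; rewrite /b (negbTE zw) powR0 ?gt_eqF// mul0r.
rewrite /b eqxx -/s => h.
have {h} : a `^ r * s <= A `^ r.
  apply: h => z; first by case: ifP.
  by case: eqP => [->|//] x /au.
move=> h; rewrite powRN.
have -> : a = (a `^ r * s) `^ r^-1 * (s `^ r^-1)^-1.
  rewrite powRM ?powR_ge0 ?(ltW s0)// -powRrM mulfV ?gt_eqF// powRr1//.
  by rewrite mulfK// gt_eqF// powR_gt0.
rewrite ler_pM2r ?invr_gt0 ?powR_gt0//.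
rewrite [leRHS](_ : A = (A `^ r) `^ r^-1); last by rewrite -powRrM mulfV ?gt_eqF// powRr1.
rewrite ge0_ler_powR ?nnegrE ?mulr_ge0 ?powR_ge0 ?(ltW s0)//.
by rewrite invr_ge0 ltW.
Qed.

Lemma energy_tile_lty u e K w : (henergy u < +oo)%E -> (energy (u \o tile e K w) < +oo)%E.
Proof.
move=> uH; have := @tile_energy_le R K (size w) u; rewrite /tile_energy.
rewrite (bigD1 e)//= (bigD1 (in_tuple w))//= => h.
apply: le_lt_trans (le_trans _ h) _.
  rewrite -addeA leeDl// adde_ge0//; apply: sume_ge0 => z _; first exact: energy_ge0.
  by apply: sume_ge0 => ? _; exact: energy_ge0.
case: (henergy u) uH (henergy_ge0 u) => // H _ _.
by rewrite -EFinM ltry.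
Qed.

Lemma energy_sum_le (H : R) u K n : (henergy u <= H%:E)%E ->
  \sum_(z : bool * n.-tuple 'I_3) fine (energy (u \o tile z.1 K z.2))
    <= (5 / 3) ^+ K * (3 / 5) ^+ n * H.
Proof.
move=> uH; have uy : (henergy u < +oo)%E by apply: le_lt_trans uH _; rewrite ltry.
rewrite -lee_fin -sumEFin.
under eq_bigr do rewrite fineK ?ge0_fin_numE ?energy_ge0 ?energy_tile_lty//.
have := @tile_energy_le R K n u; rewrite /tile_energy pair_big/= => h.
by apply: le_trans h _; rewrite [leRHS]EFinM; apply: lee_wpmul2l => //.
Qed.


(** Raising the scale and the word length together enlarges the region while the cells keep their
    size. *)
Lemma cell_scaleD K0 n0 j : 3 ^+ (K0 + j) / 3 ^+ (n0 + j) = 3 ^+ K0 / 3 ^+ n0 :> R.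
Proof. by rewrite !exprD invfM mulrACA mulfV ?mulr1// expf_neq0. Qed.

Lemma energy_scaleD K0 n0 j (H : R) :
  (5 / 3) ^+ (K0 + j) * (3 / 5) ^+ (n0 + j) * H = (5 / 3) ^+ K0 * (3 / 5) ^+ n0 * H.
Proof.
rewrite !exprD mulrACA -[X in _ * X * H]exprMn.
by rewrite (_ : 5 / 3 * (3 / 5) = 1) ?expr1n ?mulr1//; lra.
Qed.

(** The estimate on a single cell. It settles q = oo, and with the level sent to either end it shows
    that a vanishing energy or norm forces u to vanish. *)
Lemma pointwise_bound (p : \bar R) u K0 n0 (A H : R) :
  {within hgasket, continuous u} -> (1 <= p)%E -> 0 <= A -> 0 <= H ->
  (hLnorm hnu p u <= A%:E)%E -> (henergy u <= H%:E)%E ->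
  forall x, hgasket x -> `|u x| <= A * (3 ^+ K0 / 3 ^+ n0) `^ (- rinv p) +
     10 * Num.sqrt ((5 / 3) ^+ K0 * (3 / 5) ^+ n0 * H).
Proof.
move=> cu p1 A0 H0 uA uH x; rewrite hgasket_exhaustion => -[j _ jx].
have uy : (henergy u < +oo)%E by apply: le_lt_trans uH _; rewrite ltry.
have /(exhaustion_split (n0 + j))[e [w [sw cx]]] : exhaustion (K0 + j) x.
  by apply: exhaustion_mono jx; rewrite leq_addl.
have [b [b0 bu ub]] := cell_inf cu (energy_tile_lty e (K0 + j) w uy).
apply: le_trans (ub _ cx) _; rewrite lerD//.
  by have := Lp_single cu p1 A0 uA b0 bu; rewrite sw cell_scaleD.
rewrite ler_pM2l// ler_sqrt; last by rewrite !mulr_ge0// exprn_ge0.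
rewrite -(energy_scaleD _ _ j); apply: le_trans (energy_sum_le (K0 + j) (n0 + j) uH).
rewrite (bigD1 (e, tcast sw (in_tuple w)))//= val_tcast lerDl sumr_ge0// => z _.
by rewrite fine_ge0// energy_ge0.
Qed.

(* Mediant inequality: (a + b) / (P + Q) <= max (a / P) (b / Q) <= 1. *)
Lemma level_term_le (p q a b P Q : R) : 1 <= p -> p <= q -> 2 <= q ->
  0 <= a -> a <= P -> 0 <= b -> b <= Q -> 0 < P -> 0 < Q ->
  (a + b) `^ q <= (P + Q) `^ q * ((a / P) `^ p + (b / Q) ^+ 2).
Proof.
move=> p1 pq q2 a0 aP b0 bQ P0 Q0; have PQ0 : 0 < P + Q by rewrite addr_gt0.
have q0 : 0 <= q by lra.
have aP1 : 0 <= a / P <= 1 by rewrite divr_ge0 ?(ltW P0)//= ler_pdivrMr// mul1r.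
have bQ1 : 0 <= b / Q <= 1 by rewrite divr_ge0 ?(ltW Q0)//= ler_pdivrMr// mul1r.
(* On [0, 1] powers decrease in the exponent: this is the embedding of l^p and l^2 in l^q, in
   normalised form. *)
have pw (t r : R) : 1 <= r -> r <= q -> 0 <= t <= 1 -> t `^ q <= t `^ r.
  move=> r1 rq /andP[]; rewrite le_eqVlt => /predU1P[<- _|t0 t1].
    by rewrite !powR0 ?gt_eqF//; lra.
  by apply: ger_powR => //; rewrite t0.
have key t : 0 <= t -> a <= t * P -> b <= t * Q -> (a + b) `^ q <= (P + Q) `^ q * t `^ q.
  move=> t0 atP btQ; rewrite -powRM ?(ltW PQ0)// ge0_ler_powR ?nnegrE ?addr_ge0//.
    by rewrite mulr_ge0// ltW.
  by rewrite mulrDl ![_ * t]mulrC lerD.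
have [|/ltW] := leP (a / P) (b / Q) => h.
- apply: le_trans (key (b / Q) _ _ _) _; first by case/andP: bQ1.
  + by rewrite -ler_pdivrMr.
  + by rewrite divfK// gt_eqF.
  + rewrite ler_pM2l ?powR_gt0//; apply: le_trans (pw _ 2 _ q2 bQ1) _; first by lra.
    by rewrite powR_mulrn ?lerDr ?powR_ge0//; case/andP: bQ1.
- apply: le_trans (key (a / P) _ _ _) _; first by case/andP: aP1.
  + by rewrite divfK// gt_eqF.
  + by rewrite -ler_pdivrMr.
  + rewrite ler_pM2l ?powR_gt0//; apply: le_trans (pw _ p p1 pq aP1) _.
    by rewrite lerDl sqr_ge0.
Qed.

(** P and Q are chosen so that the sums over cells of (a / P)^p and of (b / Q)^2, with b the
    oscillation bound, are each at most 1. Their total 2 is the factor in [2 * G]. *)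
Lemma level_bound (mu : {measure set (R * R)%type -> \bar R}) (p q : \bar R)
    u K0 n0 (A H G : R) :
  {within hgasket, continuous u} -> (1 <= p)%E -> (p <= q)%E -> (2%:E <= q)%E ->
  0 < A -> 0 < H -> 0 <= G ->
  (hLnorm hnu p u <= A%:E)%E -> (henergy u <= H%:E)%E ->
  (forall j e w, size w = (n0 + j)%N -> (mu (cell e (K0 + j) w) <= G%:E)%E) ->
  (hLnorm mu q u <= ((2 * G) `^ (rinv q) *
    (A * (3 ^+ K0 / 3 ^+ n0) `^ (- rinv p) +
     10 * Num.sqrt ((5 / 3) ^+ K0 * (3 / 5) ^+ n0 * H)))%:E)%E.
Proof.
move=> cu p1 pq q2 A0 H0 G0 uA uH muG.
set s := 3 ^+ K0 / 3 ^+ n0; set k := (5 / 3) ^+ K0 * (3 / 5) ^+ n0 * H.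
set P := A * _; set Q := 10 * _.
have k0 : 0 < k by rewrite !mulr_gt0// ?exprn_gt0.
have P0 : 0 < P by rewrite mulr_gt0// powR_gt0// cell_scale_gt0.
have Q0 : 0 < Q by rewrite mulr_gt0// sqrtr_gt0.
have sE j : 3 ^+ (K0 + j) / 3 ^+ (n0 + j) = s :> R.
  exact: cell_scaleD.
have kE j : (5 / 3) ^+ (K0 + j) * (3 / 5) ^+ (n0 + j) * H = k.
  exact: energy_scaleD.
have uy : (henergy u < +oo)%E by apply: le_lt_trans uH _; rewrite ltry.
pose E j (z : bool * (n0 + j).-tuple 'I_3) := fine (energy (u \o tile z.1 (K0 + j) z.2)).
have E0 j z : 0 <= E j z by rewrite fine_ge0// energy_ge0.
have EK j : \sum_z E j z <= k by rewrite -(kE j); exact: energy_sum_le.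
have EQ j z : 10 * Num.sqrt (E j z) <= Q.
  rewrite ler_pM2l// ler_sqrt; last exact: ltW.
  by apply: le_trans (EK j); rewrite (bigD1 z)//= lerDl sumr_ge0.
have aP j e w a : size w = (n0 + j)%N -> 0 <= a ->
    (forall x, cell e (K0 + j) w x -> a <= `|u x|) -> a <= P.
  move=> sw a0 au; have := Lp_single cu p1 (ltW A0) uA a0 au.
  by rewrite sw sE.
case: q pq q2 => [q||]//= pq q2; last first.
  rewrite rinvy powRr0 mul1r /hLnorm unlock; case: ifP => _; last first.
    by rewrite lee_fin ltW// addr_gt0.
  apply/ess_supP; apply: aeW => x /=; rewrite /patch; case: ifPn; last first.
    by rewrite normr0 lee_fin ltW// addr_gt0.
  move=> /set_mem xh; rewrite lee_fin.
  exact: (pointwise_bound _ _ cu p1 (ltW A0) (ltW H0) uA uH xh).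
case: p p1 pq uA @P P0 aP => [p|_|]; rewrite ?leye_eq ?leeNy_eq//.
move=> p1 pq uA P P0 aP.
have {}p1 : 1 <= p by rewrite -lee_fin.
have {}pq : p <= q by rewrite -lee_fin.
have {}q2 : 2 <= q by rewrite -lee_fin.
have p0 : 0 < p by lra. have q0 : 0 < q by lra.
have PQ0 : 0 < P + Q by rewrite addr_gt0.
rewrite rinvE//; apply/hLnorm_le => //.
  by rewrite mulr_ge0 ?powR_ge0// ltW.
rewrite powRM ?powR_ge0 ?(ltW PQ0)// -powRrM mulVf ?gt_eqF// powRr1 ?mulr_ge0//.
pose f x : \bar R := (`|(u \_ hgasket) x| `^ q)%:E.
have -> : (\int[mu]_x (`|(u \_ hgasket) x| `^ q)%:E = \int[mu]_(x in hgasket) f x)%E.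
  rewrite [RHS]integral_mkcond; apply: eq_integral => x _.
  rewrite /f /patch; case: ifPn => // _.
  by rewrite normr0 powR0// gt_eqF.
have mf : measurable_fun setT f by exact: measurable_powRfun.
have f0 x : (0 <= f x)%E by rewrite lee_fin powR_ge0.
apply: (@integral_hgasket_le _ _ _ K0) => //; first exact: measurable_funTS.
move=> K KK0; pose j := (K - K0)%N; rewrite -(subnKC KK0) -/j.
have /choice[a aP'] : forall z : bool * (n0 + j).-tuple 'I_3, exists a : R,
    [/\ 0 <= a, forall x, cell z.1 (K0 + j) z.2 x -> a <= `|u x| &
     forall x, cell z.1 (K0 + j) z.2 x -> `|u x| <= a + 10 * Num.sqrt (E j z)].
  by move=> z; apply: cell_inf => //; exact: energy_tile_lty.
have a0 z : 0 <= a z by case: (aP' z).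
have aPz z : a z <= P.
  by case: (aP' z) => ? au _; apply: aP _ au => //; rewrite size_tuple.
pose c z := (a z + 10 * Num.sqrt (E j z)) `^ q.
apply: le_trans (@integral_le_cover _ _ _ mu _
  (fun z : bool * (n0 + j).-tuple 'I_3 => cell z.1 (K0 + j) z.2) _ _ f c _ _ _ _ _) _ => //.
- by move=> z; exact: measurable_cell.
- exact: measurable_exhaustion.
- exact: measurable_funTS.
- by move=> z; rewrite powR_ge0.
- move=> x /(exhaustion_split (n0 + j))[e [w [sw cx]]].
  pose z := (e, tcast sw (in_tuple w)); exists z.
  have cz : cell z.1 (K0 + j) z.2 x by rewrite /z /= val_tcast.
  split => //; rewrite /f /patch mem_set; last exact: cell_hgasket cx.
  rewrite lee_fin ge0_ler_powR ?nnegrE ?normr_ge0 ?(ltW q0)//.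
    by rewrite addr_ge0// mulr_ge0// sqrtr_ge0.
  by case: (aP' z) => _ _; apply.
apply: (@le_trans _ _ (\sum_z (c z)%:E * G%:E)%E).
  apply: lee_sum => z _; apply: lee_wpmul2l; first by rewrite lee_fin powR_ge0.
  by apply: muG; rewrite size_tuple.
rewrite (eq_bigr (fun z => (c z * G)%:E))// sumEFin lee_fin -mulr_suml.
rewrite [leRHS]mulrAC ler_wpM2r//.
have sA : \sum_z (a z / P) `^ p <= 1.
  have h := @Lp_sum p A u (K0 + j) (n0 + j) a cu p0 (ltW A0) uA a0
    (fun z => let: And3 _ h _ := aP' z in h).
  have PE : P `^ p = A `^ p / s.
    rewrite /P rinvE// powRM ?powR_ge0 ?(ltW A0)// -powRrM mulNr mulVf ?gt_eqF//.
    by rewrite powRN powRr1// ltW// cell_scale_gt0.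
  have Pp0 : 0 < P `^ p by rewrite powR_gt0.
  rewrite (eq_bigr (fun z => (a z) `^ p / P `^ p)); last first.
    move=> z _; rewrite powRM ?invr_ge0 ?(ltW P0)//; congr (_ * _).
    by rewrite -powR_inv1 ?(ltW P0)// -powRrM mulN1r powRN.
  rewrite -mulr_suml ler_pdivrMr// mul1r PE ler_pdivlMr ?cell_scale_gt0//.
  by move: h; rewrite -mulr_suml sE.
have sB : \sum_z ((10 * Num.sqrt (E j z)) / Q) ^+ 2 <= 1.
  rewrite (eq_bigr (fun z => E j z / k)); last first.
    move=> z _; rewrite /Q expr_div_n !exprMn !sqr_sqrtr ?(ltW k0)//.
    by rewrite invfM mulrACA mulfV ?mul1r.
  by rewrite -mulr_suml ler_pdivrMr// mul1r; exact: EK.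
apply: (@le_trans _ _ (\sum_z (P + Q) `^ q *
  ((a z / P) `^ p + ((10 * Num.sqrt (E j z)) / Q) ^+ 2))).
  apply: ler_sum => z _; exact: level_term_le.
rewrite -mulr_sumr big_split/= [leRHS]mulrC ler_wpM2l ?powR_ge0//; lra.
Qed.

End LevelBound.

(** * Functions in the form domain *)

Section FormDomain.
Context {R : realType}.
Implicit Types (x y : R * R) (w v : seq 'I_3) (e : bool)
  (u f g : R * R -> R).

(** From (a + b)^2 <= 2 a^2 + 2 b^2. The factor 2 is harmless, since only finiteness of energies is
    deduced from it. *)
Lemma cell_energyD m f g :
  cell_energy m (f \+ g) <= 2 * (cell_energy m f + cell_energy m g).
Proof.
elim: m f g => [|m IH] f g /=.
  rewrite -mulrDr mulrCA ler_pM2l// -big_split mulr_sumr ler_sum// => i _.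
  rewrite -big_split mulr_sumr ler_sum// => j _ /=.
  set a := f _; set b := g _; set c := f _; set d := g _.
  have := sqr_ge0 ((a - c) - (b - d)); nra.
rewrite -mulrDr mulrCA ler_pM2l// -big_split mulr_sumr ler_sum// => i _.
exact: IH.
Qed.

Lemma energyD f g : (energy (f \+ g)%R <= 2%:E * (energy f + energy g))%E.
Proof.
apply: energy_le => m; apply: le_trans (_ : ((2 * (cell_energy m f + cell_energy m g))%:E <= _)%E).
  by rewrite lee_fin cell_energyD.
rewrite EFinM [(_ + cell_energy m g)%:E]EFinD.
by apply: lee_wpmul2l; [by rewrite lee_fin|apply: leeD]; exact: energy_ge.
Qed.

Lemma henergyD f g : (henergy (f \+ g)%R <= 2%:E * (henergy f + henergy g))%E.
Proof.
apply: (@henergy_le _ 0) => K _.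
apply: le_trans (_ : (2%:E * (tile_energy K K f + tile_energy K K g) <= _)%E).
  rewrite /tile_energy -big_split ge0_sume_distrr; last first.
    by move=> e _ /=; apply: adde_ge0; apply: sume_ge0 => w _; exact: energy_ge0.
  apply: lee_sum => e _; rewrite -big_split ge0_sume_distrr; last first.
    by move=> w _ /=; apply: adde_ge0; exact: energy_ge0.
  by apply: lee_sum => w _; exact: energyD.
by apply: lee_wpmul2l; [by rewrite lee_fin|apply: leeD]; exact: tile_energy_henergy.
Qed.

Lemma cell_energy_cvg m (f : nat -> R * R -> R) u :
  (forall x, gasket x -> f n x @[n --> \oo] --> u x) ->
  cell_energy m (f n) @[n --> \oo] --> cell_energy m u.
Proof.
elim: m f u => [|m IH] f u fu /=.
  apply: cvgMr; apply: cvg_big => //= [|i _]; first exact: add_continuous.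
  apply: cvg_big => //= [|j _]; first exact: add_continuous.
  under eq_fun do rewrite expr2.
  by rewrite expr2; apply: cvgM; apply: cvgB; apply: fu; exact: gasket_vertex.
apply: cvgMr; apply: cvg_big => //= [|i _]; first exact: add_continuous.
by apply: IH => x Gx; apply: fu; exact: gasket_contraction.
Qed.

(** Lower semicontinuity: for fixed K and m the energy is a finite sum that converges with the
    values, and the bound survives the limits in m and K. *)
Lemma henergy_lim_le (f : nat -> R * R -> R) u (c : R) :
  (forall x, hgasket x -> f n x @[n --> \oo] --> u x) ->
  (\forall n \near \oo, (henergy (f n) <= c%:E)%E) -> (henergy u <= c%:E)%E.
Proof.
move=> fu fc; apply: (@henergy_le _ 0) => K _; rewrite /tile_energy pair_big/=.
pose S m (h : R * R -> R) : R :=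
  \sum_(z : bool * K.-tuple 'I_3) cell_energy m (h \o tile z.1 K z.2).
have Su m : S m u <= c.
  have Sf : S m (f n) @[n --> \oo] --> S m u.
    apply: cvg_big => //= [|z _]; first exact: add_continuous.
    by apply: cell_energy_cvg => x Gx; apply: fu; exact: tile_hgasket.
  apply: (cvgr_to_le Sf); near=> n.
  rewrite -lee_fin; apply: (@le_trans _ _ (henergy (f n))).
    apply: le_trans (tile_energy_henergy K (f n)); rewrite /tile_energy pair_big/=.
    by rewrite -sumEFin; apply: lee_sum => z _; exact: energy_ge.
  by near: n.
have cv : (\sum_(z : bool * K.-tuple 'I_3)
    (cell_energy m (u \o tile z.1 K z.2))%:E @[m --> \oo] -->
    \sum_(z : bool * K.-tuple 'I_3) energy (u \o tile z.1 K z.2))%E.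
  apply: cvg_nnesum => z _; last exact: energy_cvg.
  by apply: nearW => m; rewrite lee_fin cell_energy_ge0.
by apply: (cvge_le _ cv); apply: nearW => m; rewrite sumEFin lee_fin; exact: Su.
Unshelve. all: by end_near. Qed.

Lemma hLnormD (mu : {measure set (R * R)%type -> \bar R}) (r : R) f g :
  {within hgasket, continuous f} -> {within hgasket, continuous g} -> 1 <= r ->
  (hLnorm mu r%:E (f \+ g)%R <= hLnorm mu r%:E f + hLnorm mu r%:E g)%E.
Proof.
move=> cf cg r1; rewrite /hLnorm.
have -> : (f \+ g)%R \_ hgasket = (f \_ hgasket \+ g \_ hgasket)%R.
  by apply/funext => x /=; rewrite /patch; case: ifPn => //; rewrite addr0.
apply: minkowski_EFin => //; exact: measurable_hgasket_fun.
Qed.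

(** Fatou's lemma, as the limit of the Cauchy sequence is given only pointwise. *)
Lemma hLnorm_lim_le (mu : {measure set (R * R)%type -> \bar R})
    (f : nat -> R * R -> R) u (c : R) : 0 <= c ->
  (forall n, {within hgasket, continuous (f n)}) ->
  (forall x, hgasket x -> f n x @[n --> \oo] --> u x) ->
  (forall n, (hLnorm mu 2%:E (f n) <= c%:E)%E) ->
  (hLnorm mu 2%:E u <= c%:E)%E.
Proof.
move=> c0 cf fu fc; apply/hLnorm_le => //.
pose F n x : \bar R := (`|(f n \_ hgasket) x| `^ 2)%:E.
have F0 n x : (0 <= F n x)%E by rewrite lee_fin powR_ge0.
have mF n : measurable_fun setT (F n) by exact: measurable_powRfun.
have -> : (\int[mu]_x (`|(u \_ hgasket) x| `^ 2)%:E =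
    \int[mu]_x limn_einf (F ^~ x))%E.
  apply: eq_integral => x _.
  suff h : F n x @[n --> \oo] --> (`|(u \_ hgasket) x| `^ 2)%:E.
    by rewrite (cvg_limn_einf_sup h).1.
  suff hr : `|(f n \_ hgasket) x| `^ 2 @[n --> \oo] --> `|(u \_ hgasket) x| `^ 2.
    by apply: cvg_EFin; [exact: nearW|exact: hr].
  rewrite (_ : (fun n => `|(f n \_ hgasket) x| `^ 2) =
    (fun n => `|(f n \_ hgasket) x| * `|(f n \_ hgasket) x|)); last first.
    by apply/funext => n; rewrite powR_mulrn// expr2.
  rewrite powR_mulrn// expr2.
  have h : (f n \_ hgasket) x @[n --> \oo] --> (u \_ hgasket) x.
    by rewrite /patch; case: ifPn => [/set_mem hx|_]; [exact: fu|exact: cvg_cst].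
  by apply: cvgM; exact: cvg_norm.
apply: le_trans (fatou _ _ mF _) _ => //.
rewrite limn_einf_lim; apply: lime_le; first exact: is_cvg_einfs.
apply: nearW => n; apply: le_trans (_ : (\int[mu]_x F n x <= _)%E).
  by apply: ereal_inf_lbound; exists n => //=.
by apply/hLnorm_le.
Qed.

Variable hnu : {measure set (R * R)%type -> \bar R}.

Lemma form_norm_lt u (c : R) : 0 <= c -> (form_norm hnu u < c%:E)%E ->
  (henergy u <= (c ^+ 2)%:E)%E /\ (hLnorm hnu 2%:E u <= c%:E)%E.
Proof.
move=> c0 uc; have e0 := henergy_ge0 u; have L0 : (0 <= hLnorm hnu 2%:E u)%E by exact: Lnorm_ge0.
split; last first.
  by apply/ltW; apply: le_lt_trans uc; rewrite /form_norm leeDr// poweR_ge0.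
have h : (henergy u `^ 2^-1 <= c%:E)%E.
  by apply/ltW; apply: le_lt_trans uc; rewrite /form_norm leeDl.
have -> : henergy u = ((henergy u `^ 2^-1) `^ 2)%E.
  by rewrite -poweRrM mulVf// poweRe1.
rewrite -powR_mulrn// -poweR_EFin; apply: gt0_ler_poweR => //.
- by rewrite in_itv/= leey poweR_ge0.
- by rewrite in_itv/= leey andbT lee_fin.
Qed.

(** From some index N on, the sequence stays at distance less than 1 from [v N]; both parts of the
    norm are lower semicontinuous, so they are finite at the limit. *)
Lemma form_domain_finite u : form_domain hnu u ->
  [/\ {within hgasket, continuous u}, (henergy u < +oo)%E &
      (hLnorm hnu 2%:E u < +oo)%E].
Proof.
move=> [cu [v [core cau vu]]]; split => //.
  have [N NP] := cau 1 ltr01; have [_ _ eN] := core N.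
  have -> : u = ((u \- v N) \+ v N)%R by apply/funext => x /=; rewrite subrK.
  apply: le_lt_trans (henergyD _ _) _.
  apply: lte_mul_pinfty => //; apply: lte_add_pinfty => //.
  apply: le_lt_trans (_ : (_ <= 1%:E)%E) _; last by rewrite ltry.
  apply: (@henergy_lim_le (fun n => (v n \- v N)%R)) => [x hx|].
    by apply: cvgB; [exact: vu|exact: cvg_cst].
  exists N => // n /= Nn.
  by have [] := form_norm_lt ler01 (NP n N Nn (leqnn N)); rewrite expr1n.
have [N NP] := cau 1 ltr01; have [cN LN _] := core N.
have LNf : hLnorm hnu 2%:E (v N) \is a fin_num.
  by rewrite ge0_fin_numE//; exact: Lnorm_ge0.
pose M := fine (hLnorm hnu 2%:E (v N)).
apply: le_lt_trans (_ : (_ <= (M + 1)%:E)%E) _; last by rewrite ltry.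
apply: (@hLnorm_lim_le _ (fun n => v (n + N)%N)).
- by rewrite addr_ge0// fine_ge0//; exact: Lnorm_ge0.
- by move=> n; case: (core (n + N)%N).
- by move=> x hx; rewrite (cvg_shiftn N (fun n => v n x)); exact: vu.
- move=> n; have [cn _ _] := core (n + N)%N.
  have -> : v (n + N)%N = (v N \+ (v (n + N)%N \- v N))%R.
    by apply/funext => x /=; rewrite addrC subrK.
  apply: le_trans (hLnormD _ _ _ _) _; rewrite ?ler1n//.
    by move=> x; apply: cvgB; [exact: cn|exact: cN].
  rewrite [leRHS]EFinD; apply: leeD; first by rewrite fineK.
  by have [] := form_norm_lt ler01 (NP (n + N)%N N (leq_addl _ _) (leqnn N)).
Qed.


End FormDomain.

(** * Optimisation over the level *)

Section Optimisation.
Context {R : realType}.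
Implicit Types (K n : nat).

Lemma ln3_gt0 : 0 < ln 3 :> R. Proof. by rewrite ln_gt0// ltr1n. Qed.

Lemma inv_delta_s_gt0 : 0 < inv_delta_s :> R.
Proof.
rewrite /inv_delta_s subr_gt0 ltr_pdivlMr ?ln3_gt0// mul1r ltr_ln ?posrE//.
by rewrite ltr_nat.
Qed.

Lemma expR_nat_ln (a : R) n : 0 < a -> a ^+ n = expR (n%:R * ln a).
Proof. by move=> a0; rewrite expRM_natl lnK. Qed.

Lemma cell_scale_expR K n : 3 ^+ K / 3 ^+ n = expR ((K%:R - n%:R) * ln 3) :> R.
Proof. by rewrite mulrBl expRD expRN !expR_nat_ln. Qed.

Lemma energy_scale_expR K n : (5 / 3) ^+ K * (3 / 5) ^+ n =
  expR ((K%:R - n%:R) * ln 3 * inv_delta_s) :> R.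
Proof.
have -> : 3 / 5 = (5 / 3)^-1 :> R by rewrite invf_div.
rewrite exprVn mulrAC -mulrA !expR_nat_ln ?divr_gt0// -expRN -expRD -mulrBl.
congr expR; rewrite mulrA mulrAC -!mulrA; congr (_ * _).
rewrite ln_div ?posrE// /inv_delta_s mulrBr mulr1 mulrC divfK//.
by rewrite gt_eqF// ln3_gt0.
Qed.

(** The integer part of t / ln 3 is written as K - n with one of K, n equal to 0. Rounding down
    preserves the side of 0, so the level obeys the growth exponent that belongs to the sign of
    t. *)
Lemma exists_level (t : R) : exists K n, let t0 := (K%:R - n%:R) * ln 3 in
  [/\ t0 <= t, t < t0 + ln 3, 0 <= t -> n = 0%N & t < 0 -> K = 0%N /\ (0 < n)%N].
Proof.
have l3 := ln3_gt0.
have m1 : (Num.floor (t / ln 3))%:~R * ln 3 <= t by rewrite -ler_pdivlMr// floor_le.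
have m2 : t < (Num.floor (t / ln 3))%:~R * ln 3 + ln 3.
  by rewrite -[X in _ + X]mul1r -mulrDl -ltr_pdivrMr// -intrD1 floorD1_gt.
have := floor_lt0 (t / ln 3); rewrite ltr_pdivrMr// mul0r.
case: (Num.floor _) m1 m2 => k m1 m2 tk.
- exists k, 0%N => /=; rewrite subr0; split => //.
  by rewrite -tk.
- exists 0%N, k.+1 => /=; move: m1 m2; rewrite NegzE mulrNz sub0r => m1 m2.
  split => //; by rewrite leNgt -tk.
Qed.

(** At t, where expR al * s^(-ip) and s^(inv_delta_s / 2) * expR h coincide, the product on the
    right is expR (al - t * ip + t * d * iq). Rounding t down to t0 lowers the measure factor and
    the energy term, and raises the norm term by at most 3 because ip <= 1. *)
Lemma level_optimum (C ip iq d al h t : R) K n :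
  let k := ip + inv_delta_s / 2 in let t0 := (K%:R - n%:R) * ln 3 in
  let a := (ip - iq * d) / k in let A := expR al in let H := expR (2 * h) in
  1 <= C -> 0 <= ip <= 1 -> 0 <= iq <= 1 -> 0 <= d -> t = (al - h) / k ->
  t0 <= t -> t < t0 + ln 3 ->
  (2 * (C * (3 ^+ K / 3 ^+ n) `^ d)) `^ iq *
    (A * (3 ^+ K / 3 ^+ n) `^ (- ip) +
     10 * Num.sqrt ((5 / 3) ^+ K * (3 / 5) ^+ n * H))
  <= 26 * C * (H `^ (a / 2) * A `^ (1 - a)).
Proof.
move=> k t0 a A H C1 /andP[ip0 ip1] /andP[iq0 iq1] d0 tE t0t tt0.
have ids0 := inv_delta_s_gt0.
have k0 : 0 < k by rewrite /k; lra.
have tk : t * k = al - h by rewrite tE divfK// gt_eqF.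
have ak : a * k = ip - iq * d by rewrite /a divfK// gt_eqF.
have aE : a * (al - h) = t * (ip - iq * d) by rewrite -tk -ak; ring.
have C0 : 0 < C by lra.
have -> : H `^ (a / 2) * A `^ (1 - a) = expR (al - t * ip + t * d * iq).
  rewrite -!expRM -expRD; congr expR.
  by move: aE; lra.
rewrite cell_scale_expR energy_scale_expR -/t0 -!expRM -!expRD.
rewrite -powR12_sqrt ?expR_ge0// -expRM mulrA powRM ?expR_ge0 ?mulr_ge0 ?(ltW C0)//.
rewrite -expRM.
have h1 : (2 * C) `^ iq <= 2 * C by apply: ler1_powR; lra.
have h2 : expR (t0 * d * iq) <= expR (t * d * iq).
  by rewrite ler_expR; apply: ler_wpM2r => //; exact: ler_wpM2r.
have h3 : expR (al + t0 * - ip) <= 3 * expR (al - t * ip).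
  have e3 : 3 = expR (ln 3) :> R by rewrite lnK ?posrE.
  rewrite [X in _ <= X * _]e3 -expRD ler_expR.
  have : (t - t0) * ip <= ln 3.
    apply: le_trans (_ : (t - t0) * 1 <= _); last by lra.
    by apply: ler_wpM2l => //; lra.
  lra.
have h4 : expR ((t0 * inv_delta_s + 2 * h) / 2) <= expR (al - t * ip).
  rewrite ler_expR.
  have : t0 * inv_delta_s <= t * inv_delta_s by rewrite ler_wpM2r// ltW.
  by move: tk; rewrite /k mulrDr; lra.
rewrite [X in _ <= _ * X]expRD.
(* Here 13 = 3 + 10, from the rounding of the norm term and the oscillation constant, and 26 = 2 *
   13. *)
apply: (@le_trans _ _ (2 * C * expR (t * d * iq) * (13 * expR (al - t * ip)))).
  apply: ler_pM; rewrite ?mulr_ge0 ?powR_ge0 ?expR_ge0//.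
  - by apply: ler_pM; rewrite ?powR_ge0 ?expR_ge0.
  - lra.
rewrite le_eqVlt; apply/orP; left; apply/eqP; ring.
Qed.

(** The bound on [Num.sqrt H] expresses that the balanced level is at least s = 1. The constant 2 *
    (1 + 10) = 22 fits below 26. *)
Lemma level_zero (C iq A H : R) : 1 <= C -> 0 <= iq <= 1 -> 0 <= A -> 0 <= H ->
  Num.sqrt H <= A ->
  (2 * C) `^ iq * (A + 10 * Num.sqrt H) <= 26 * C * A.
Proof.
move=> C1 /andP[iq0 iq1] A0 H0 HA.
have h1 : (2 * C) `^ iq <= 2 * C by apply: ler1_powR; lra.
apply: (@le_trans _ _ (2 * C * (11 * A))).
  by apply: ler_pM; rewrite ?powR_ge0 ?addr_ge0 ?mulr_ge0 ?sqrtr_ge0//; lra.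
have : 0 <= C * A by rewrite mulr_ge0//; lra.
lra.
Qed.

End Optimisation.

(** * The Sobolev inequality *)

Section SobolevInequality.
Context {R : realType}.
Implicit Types (u : R * R -> R) (w : seq 'I_3).
Variables (nu : probability (R * R)%type R)
  (hnu : {measure set (R * R)%type -> \bar R}).
Hypotheses (nuP : is_gasket_measure nu) (hnuP : is_hgasket_measure nu hnu).

Lemma rinv_bounds (p : \bar R) : (1 <= p)%E -> 0 <= rinv p <= 1.
Proof.
case: p => [r||]//= r1; last by rewrite rinvy lexx ler01.
have {}r1 : 1 <= r by rewrite -lee_fin.
by rewrite rinvE ?invr_ge0 ?invf_le1; lra.
Qed.

Lemma rinv_gt0_ge0 (p : \bar R) : (0 < p)%E -> 0 <= rinv p.
Proof.
case: p => [r r0|_|]; last by rewrite ltNge leNye.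
  by rewrite rinvE ?invr_ge0 ?ltW// -lte_fin.
by rewrite rinvy.
Qed.

Lemma rinv_le (p q : \bar R) : (0 < p)%E -> (p <= q)%E -> rinv q <= rinv p.
Proof.
move=> p0; have := rinv_gt0_ge0 p0; case: q => [q|h _|_]; last 2 first.
- by rewrite rinvy.
- by rewrite leeNy_eq => /eqP pE; rewrite pE in p0.
case: p p0 => [p|_ _|]; last 2 first.
- by rewrite leye_eq.
- by rewrite ltNge leNye.
rewrite lte_fin lee_fin => p0 _ pq; have q0 := lt_le_trans p0 pq.
by rewrite !rinvE// lef_pV2 ?posrE.
Qed.

Lemma growth_cell (sigma : {measure set (R * R)%type -> \bar R}) (C : R)
    (dlow dup : \bar R) e K w : dyadic_growth hnu sigma C dlow dup ->
  (sigma (cell e K w) <= (C * (3 ^+ K / 3 ^+ size w) `^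
     rinv (if (size w <= K)%N then dlow else dup))%:E)%E.
Proof.
move=> /(_ (cell e K w)) []; first by apply/dyadic_cellP; exists e, K, w.
rewrite diam_cell (measure_cell nuP hnuP) !poweR_EFin -!EFinM !lte_fin !lee_fin.
have pow2_gt0 n : 0 < 2 ^+ n :> R by rewrite exprn_gt0.
rewrite ler_pdivlMr// mul1r ltr_pdivrMr// mul1r divr_gt0//=.
rewrite ler_eXn2l ?ltr1n// ltr_eXn2l ?ltr1n// ltnNge.
by case: leqP => h h1 h2; [exact: h2|exact: h1].
Qed.

Lemma hLnorm_eq0 (mu : {measure set (R * R)%type -> \bar R}) (q : \bar R) u :
  (0 < q)%E -> (forall x, hgasket x -> u x = 0) -> hLnorm mu q u = 0%E.
Proof.
move=> q0 u0; rewrite /hLnorm.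
have -> : EFin \o u \_ hgasket = cst 0%E.
  by apply/funext => x /=; rewrite /patch; case: ifPn => // /set_mem/u0 ->.
by apply: Lnorm0; rewrite gt_eqF.
Qed.

Lemma sobolev_term_ge0 (p : \bar R) a u : (0 <= sobolev_term hnu p a u)%E.
Proof. by apply: mule_ge0; exact: poweR_ge0. Qed.

Lemma sobolev_denominator_gt0 (p : \bar R) : (1 <= p)%E ->
  0 < rinv p + inv_delta_s / 2.
Proof. by move=> /rinv_bounds/andP[? _]; have := @inv_delta_s_gt0 R; lra. Qed.

Lemma sobolev_exponent_lt1 (p q d : \bar R) : (1 <= p)%E -> (1 <= q)%E ->
  (0 < d)%E -> sobolev_exponent p q d < 1.
Proof.
move=> p1 q1 d0; rewrite /sobolev_exponent gt_max ltr01 andbT.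
have k0 := sobolev_denominator_gt0 p1.
rewrite ltr_pdivrMr// mul1r; have /andP[q0 _] := rinv_bounds q1.
have := mulr_ge0 q0 (rinv_gt0_ge0 d0); have := @inv_delta_s_gt0 R; lra.
Qed.

Lemma expR_decay_le0 (c k : R) x : 0 <= c -> 0 < k ->
  (forall n, x <= c * expR (- n%:R * k)) -> x <= 0.
Proof.
move=> c0 k0 h; have cv : c * expR (- n%:R * k) @[n --> \oo] --> c * 0.
  apply: cvgMr; under eq_fun do rewrite mulNr mulrC -mulNr mulrC expRM_natl.
  apply: cvg_expr; rewrite ger0_norm ?expR_ge0//.
  by rewrite -expR0 ltr_expR oppr_lt0.
rewrite mulr0 in cv; apply: (cvgr_to_ge cv); exact: nearW.
Qed.

(** Without energy only the norm term of [pointwise_bound] remains, and it decays as the cells grow.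
    The L^2 norm is used because it is known to be finite. *)
Lemma henergy_eq0 u : form_domain hnu u -> henergy u = 0%E ->
  forall x, hgasket x -> u x = 0.
Proof.
move=> /form_domain_finite[cu _ Lu] H0 x hx.
have Lf : hLnorm hnu 2%:E u \is a fin_num by rewrite ge0_fin_numE//; exact: Lnorm_ge0.
set A := fine (hLnorm hnu 2%:E u).
have A0 : 0 <= A by rewrite fine_ge0//; exact: Lnorm_ge0.
have uA : (hLnorm hnu 2%:E u <= A%:E)%E by rewrite /A fineK.
have uH : (henergy u <= 0%:E)%E by rewrite H0.
have h K := pointwise_bound nuP hnuP K 0 cu (ltac:(by rewrite lee_fin ler1n) : (1 <= 2%:E)%E)
  A0 (lexx 0) uA uH hx.
apply/eqP; rewrite -normr_eq0 eq_le normr_ge0 andbT.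
apply: (@expR_decay_le0 A (2^-1 * ln 3)) => //; first by rewrite mulr_gt0// ln3_gt0.
move=> n; apply: le_trans (h n) _.
rewrite mulr0 sqrtr0 mulr0 addr0 cell_scale_expR rinvE// -expRM subr0 le_eqVlt.
by apply/orP; left; apply/eqP; congr (_ * expR _); ring.
Qed.

(** Without norm only the energy term remains, and it decays as the cells shrink. *)
Lemma hLnorm_eq0_eq0 (p : \bar R) u : form_domain hnu u -> (1 <= p)%E ->
  hLnorm hnu p u = 0%E -> forall x, hgasket x -> u x = 0.
Proof.
move=> /form_domain_finite[cu Hu _] p1 A0 x hx.
have Hf : henergy u \is a fin_num by rewrite ge0_fin_numE// henergy_ge0.
set H := fine (henergy u).
have H0 : 0 <= H by rewrite fine_ge0// henergy_ge0.
have uH : (henergy u <= H%:E)%E by rewrite /H fineK.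
have uA : (hLnorm hnu p u <= 0%:E)%E by rewrite A0.
have h n := pointwise_bound nuP hnuP 0 n cu p1 (lexx 0) H0 uA uH hx.
apply/eqP; rewrite -normr_eq0 eq_le normr_ge0 andbT.
apply: (@expR_decay_le0 (10 * H `^ 2^-1) (2^-1 * (ln 3 * inv_delta_s))).
- by rewrite mulr_ge0// powR_ge0.
- by rewrite !mulr_gt0// ?ln3_gt0// inv_delta_s_gt0.
move=> n; apply: le_trans (h n) _.
rewrite mul0r add0r energy_scale_expR sub0r -powR12_sqrt ?mulr_ge0 ?expR_ge0//.
rewrite powRM ?expR_ge0// -expRM le_eqVlt; apply/orP; left; apply/eqP.
by rewrite -[RHS]mulrA [X in _ = _ * X]mulrC; congr (_ * (expR _ * _)); ring.
Qed.

(** The choice of t takes logarithms, so norm and energy must be positive and finite; if either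
    vanishes, u is 0 on the gasket. The sign of t then decides which growth exponent governs the
    level. *)
Lemma sobolev_inequality (C : R) (p q dlow dup : \bar R)
    (sigma : {measure set (R * R)%type -> \bar R}) u : 1 <= C ->
  (1 <= p)%E -> (p <= q)%E -> (2%:E <= q)%E ->
  (0 < dlow)%E -> (dlow <= dup)%E -> (1 <= dup)%E ->
  dyadic_growth hnu sigma C dlow dup -> form_domain hnu u ->
  (hLnorm sigma q u <=
     (26 * C)%:E * (sobolev_term hnu p (sobolev_exponent p q dup) u +
             sobolev_term hnu p (sobolev_exponent p q dlow) u))%E.
Proof.
move=> C1 p1 pq q2 dl0 dlu du1 gr fu.
have C0 : 0 < C by lra.
have q1 : (1 <= q)%E := le_trans p1 pq.
have q0 : (0 < q)%E by apply: lt_le_trans q1.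
have [cu Hu _] := form_domain_finite fu.
have rhs0 : (0 <= sobolev_term hnu p (sobolev_exponent p q dup) u +
             sobolev_term hnu p (sobolev_exponent p q dlow) u)%E.
  by apply: adde_ge0; exact: sobolev_term_ge0.
have [u0|nu0] := pselect (forall x, hgasket x -> u x = 0).
  by rewrite hLnorm_eq0//; apply: mule_ge0 => //; rewrite lee_fin; lra.
have Hf : henergy u \is a fin_num by rewrite ge0_fin_numE// henergy_ge0.
have HE : henergy u = (fine (henergy u))%:E by rewrite fineK.
have H0 : 0 < fine (henergy u).
  rewrite lt_neqAle fine_ge0 ?henergy_ge0// andbT eq_sym; apply/eqP => h.
  by apply: nu0; apply: henergy_eq0 fu _; rewrite HE h.
move: (fine (henergy u)) HE H0 => H HE H0.
have dup0 : (0 < dup)%E := lt_le_trans dl0 dlu.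
have a1lt := sobolev_exponent_lt1 p1 q1 dup0.
(* For an infinite norm the first term is infinite: the power 1 - a_1 is positive and the energy
   factor is not 0. *)
have [Ay|Af] := eqVneq (hLnorm hnu p u) +oo%E.
  rewrite [sobolev_term _ _ (sobolev_exponent _ _ dup) _]/sobolev_term HE Ay.
  rewrite poweRyr; last by rewrite subr_eq0 gt_eqF.
  rewrite poweR_EFin gt0_muley ?lte_fin ?powR_gt0//.
  rewrite addye; last by rewrite gt_eqF// (lt_le_trans _ (sobolev_term_ge0 _ _ _)).
  by rewrite gt0_muley ?leey// lte_fin; lra.
have A0 : 0 < fine (hLnorm hnu p u).
  rewrite lt_neqAle fine_ge0 ?Lnorm_ge0// andbT eq_sym; apply/eqP => h.
  apply: nu0; apply: hLnorm_eq0_eq0 fu p1 _; rewrite -(fineK (x := hLnorm hnu p u)) ?h//.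
  by rewrite ge0_fin_numE ?lt_neqAle ?Af ?leey//; exact: Lnorm_ge0.
have AE : hLnorm hnu p u = (fine (hLnorm hnu p u))%:E.
  by rewrite fineK// ge0_fin_numE ?lt_neqAle ?Af ?leey//; exact: Lnorm_ge0.
move: (fine (hLnorm hnu p u)) AE A0 => A AE A0.
have termE a : sobolev_term hnu p a u = (H `^ (a / 2) * A `^ (1 - a))%:E.
  by rewrite /sobolev_term HE AE !poweR_EFin -EFinM.
rewrite !termE -EFinD -EFinM.
set ip := rinv p; set iq := rinv q.
have /andP[ip0 ip1] : 0 <= ip <= 1 by exact: rinv_bounds.
have /andP[iq0 iq1] : 0 <= iq <= 1 by exact: rinv_bounds.
pose k := ip + inv_delta_s / 2; have k0 : 0 < k by exact: sobolev_denominator_gt0.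
pose t := (ln A - ln H / 2) / k.
have [K [n [t0t tt0 tn tK]]] := exists_level t.
have Ae : A = expR (ln A) by rewrite lnK.
have He : H = expR (2 * (ln H / 2)) by rewrite mulrCA mulfV// mulr1 lnK.
have uA : (hLnorm hnu p u <= A%:E)%E by rewrite AE.
have uH : (henergy u <= H%:E)%E by rewrite HE.
have lb K' n' G (G0 : 0 <= G) := level_bound nuP hnuP (mu := sigma)
  (K0 := K') (n0 := n') cu p1 pq q2 A0 H0 G0 uA uH.
have opt d (d0 : 0 <= d) := @level_optimum R C ip iq d (ln A) (ln H / 2) t K n C1
  (introT andP (conj ip0 ip1)) (introT andP (conj iq0 iq1)) d0 erefl t0t tt0.
have G0 d : 0 <= C * (3 ^+ K / 3 ^+ n) `^ d.
  by rewrite mulr_ge0 ?powR_ge0// ltW.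
rewrite -Ae -He in opt.
have rhs1 a : 0 <= H `^ (a / 2) * A `^ (1 - a) by rewrite mulr_ge0// powR_ge0.
have [t_ge0|t_lt0] := leP 0 t; last first.
  have [K0 n0] := tK t_lt0.
  apply: le_trans (lb K n _ (G0 (rinv dup)) _) _.
    move=> j e w sw; apply: le_trans (growth_cell e _ w gr) _.
    rewrite sw cell_scaleD K0 add0n leqNgt -{1}(add0n j) ltn_add2r n0/=.
    by [].
  rewrite lee_fin; apply: le_trans (opt _ (rinv_gt0_ge0 dup0)) _.
  rewrite ler_pM2l; last by rewrite mulr_gt0.
  (* The positive part is inactive for [dup], since 1/q <= 1/p and 1/dup <= 1. *)
  have -> : sobolev_exponent p q dup = (ip - iq * rinv dup) / k.
    rewrite /sobolev_exponent; apply/max_idPl; apply: divr_ge0; last exact: ltW.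
    have /andP[? du] := rinv_bounds du1.
    have qp : iq <= ip by apply: rinv_le pq; apply: lt_le_trans p1.
    rewrite subr_ge0; apply: le_trans qp.
    by rewrite ler_piMr.
  by rewrite lerDl.
have n0 := tn t_ge0.
have [a_ge0|a_lt0] := leP 0 (ip - iq * rinv dlow).
  apply: le_trans (lb K n _ (G0 (rinv dlow)) _) _.
    move=> j e w sw; apply: le_trans (growth_cell e _ w gr) _.
    by rewrite sw cell_scaleD n0 add0n leq_addl.
  rewrite lee_fin; apply: le_trans (opt _ (rinv_gt0_ge0 dl0)) _.
  rewrite ler_pM2l; last by rewrite mulr_gt0.
  have -> : sobolev_exponent p q dlow = (ip - iq * rinv dlow) / k.
    by rewrite /sobolev_exponent; apply/max_idPl; apply: divr_ge0; last exact: ltW.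
  by rewrite lerDr.
(* For a negative untruncated exponent a, the balanced bound would be A * (A / sqrt H)^(-a), which
   is at least A because sqrt H <= A. The level s = 1 does better and matches the truncated
   exponent. *)
have -> : sobolev_exponent p q dlow = 0.
  rewrite /sobolev_exponent; apply/max_idPr.
  by rewrite pmulr_lle0 ?invr_gt0// ltW.
apply: le_trans (lb 0 0 C (ltW C0) _) _.
  move=> j e w sw; apply: le_trans (growth_cell e _ w gr) _.
  by rewrite sw cell_scaleD !add0n leqnn expr0 divr1 powR1 mulr1.
rewrite !expr0 divr1 powR1 !mulr1 !mul1r mul0r powRr0 subr0 powRr1 ?mul1r ?(ltW A0)//.
rewrite lee_fin; apply: (@le_trans _ _ (26 * C * A)).
  apply: level_zero => //; rewrite ?iq0 ?iq1 ?(ltW A0) ?(ltW H0)//.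
  rewrite -powR12_sqrt ?(ltW H0)// Ae He -expRM ler_expR.
  have : 0 <= t * k by rewrite mulr_ge0// ltW.
  rewrite /t divfK ?gt_eqF//; lra.
by rewrite ler_pM2l ?lerDr//; rewrite mulr_gt0.
Qed.

End SobolevInequality.

(** * Harmonic functions *)

Section Harmonic.
Context {R : realType}.
Implicit Types (x y : R * R) (i j : 'I_3) (w v : seq 'I_3) (e : bool)
  (u f g : R * R -> R) (a : 'I_3 -> R).

(* The boundary values on the i-th subcell of the harmonic function with
   boundary values a (the "1/5-2/5 rule"). *)
Definition sub_boundary i a : 'I_3 -> R :=
  fun j => if j == i then a i else (a i + a j + \sum_k a k) / 5.

Definition boundary_energy a : R :=
  2^-1 * \sum_i \sum_j (a i - a j) ^+ 2.

(** Consistency at the common midpoint of two subcells, which makes gluing possible. *)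
Lemma sub_boundaryC i j a : sub_boundary i a j = sub_boundary j a i.
Proof.
rewrite /sub_boundary eq_sym; case: eqP => [->//|_].
by rewrite [a i + _]addrC.
Qed.

(** The equality case of the monotonicity of energies: harmonic extension adds no energy at any
    level. *)
Lemma sub_boundary_energy a :
  5 / 3 * \sum_i boundary_energy (sub_boundary i a) = boundary_energy a.
Proof.
rewrite /boundary_energy !big_I3/= /sub_boundary/= !big_I3/=; by field.
Qed.

Lemma sub_boundary_bounds i a lo hi : (forall j, lo <= a j <= hi) ->
  forall j, lo <= sub_boundary i a j <= hi.
Proof.
move=> ah j; rewrite /sub_boundary; case: ifP => // _; rewrite big_I3/=.
have /andP[? ?] := ah i; have /andP[? ?] := ah j.
have /andP[? ?] := ah (@Ordinal 3 0 isT); have /andP[? ?] := ah (@Ordinal 3 1 isT).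
by have /andP[? ?] := ah (@Ordinal 3 2 isT); apply/andP; split; lra.
Qed.

Definition spread (d : R) a := forall i j, `|a i - a j| <= d.

(** The factor 3/5 is attained by the boundary values 1, 0, 0, which become 1, 2/5, 2/5. It drives
    the convergence of the splines and the continuity of their limit. *)
Lemma sub_boundary_spread d i a : spread d a -> spread (3 / 5 * d) (sub_boundary i a).
Proof.
move=> ad j k.
have h p q : - d <= a p - a q <= d by rewrite -ler_norml ad.
have := h (@Ordinal 3 0 isT) (@Ordinal 3 1 isT).
have := h (@Ordinal 3 0 isT) (@Ordinal 3 2 isT).
have := h (@Ordinal 3 1 isT) (@Ordinal 3 2 isT).
rewrite /sub_boundary big_I3/= ler_norml.
move=> /andP[? ?] /andP[? ?] /andP[? ?].
elim/I3P: i; elim/I3P: j; elim/I3P: k => /=; apply/andP; split; lra.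
Qed.

(** The i-th subcell is where coordinate i is at least 1/2. Two indices qualify at a midpoint; the
    fixed order picks one, and [spline_contraction] shows that the pick is immaterial. *)
Definition cell_index x : 'I_3 :=
  if 2^-1 <= lam (@Ordinal 3 0 isT) x then @Ordinal 3 0 isT
  else if 2^-1 <= lam (@Ordinal 3 1 isT) x then @Ordinal 3 1 isT
  else @Ordinal 3 2 isT.

Lemma cell_indexP x i : 2^-1 <= lam i x -> 2^-1 <= lam (cell_index x) x.
Proof.
rewrite /cell_index; case: ifP => [//|h0]; case: ifP => [//|h1].
by elim/I3P: i; rewrite ?h0 ?h1.
Qed.

(* Agrees with the harmonic function at the vertices of level n and is affine on
   the cells of level n. *)
Fixpoint spline n a x : R :=
  if n is n'.+1 then
    spline n' (sub_boundary (cell_index x) a) (contractionV (cell_index x) x)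
  else \sum_i a i * lam i x.

Lemma cell_index_vertex i : cell_index (vertex i) = i.
Proof.
rewrite /cell_index !lam_vertex.
by elim/I3P: i => /=; rewrite ?invf_le1 ?ler1n// leNgt invr_gt0 ltr0n//= invf_le1 ?ler1n.
Qed.

Lemma spline_vertex n a i : spline n a (vertex i) = a i.
Proof.
elim: n a => [|n IH] a /=.
  rewrite (bigD1 i)//= lam_vertex eqxx mulr1 big1 ?addr0// => j ji.
  by rewrite lam_vertex (negbTE ji) mulr0.
rewrite cell_index_vertex -{1}(contraction_vertex i) contractionK IH.
by rewrite /sub_boundary eqxx.
Qed.

Lemma spline_contraction n a i x : triangle x ->
  spline n.+1 a (contraction i x) = spline n (sub_boundary i a) x.
Proof.
move=> Tx /=; set j := cell_index _.
have [ji|ji] := eqVneq j i; first by rewrite ji contractionK.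
have : 2^-1 <= lam j (contraction i x).
  apply: (@cell_indexP _ i); rewrite lam_contraction eqxx.
  by have := Tx i => ? /=; lra.
rewrite lam_contraction (negbTE ji) /= => h.
(* A pick other than i occurs only at the midpoint shared with the j-th subcell, where
   [sub_boundaryC] identifies the values. *)
have xj : x = vertex j.
  by apply: triangle_lam1 => //; have := triangle_lam_le1 j Tx; lra.
rewrite [in X in contraction i X]xj contraction_vertexC contractionK xj.
by rewrite !spline_vertex sub_boundaryC.
Qed.

Lemma spline_bounds n a x lo hi : (forall j, lo <= a j <= hi) -> gasket x ->
  lo <= spline n a x <= hi.
Proof.
elim: n a x => [|n IH] a x ah Gx.
  have Tx := gasket_triangle Gx; have s1 := lam_sum x.
  rewrite /= -[lo]mulr1 -[hi]mulr1 -s1 !mulr_sumr.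
  by apply/andP; split; apply: ler_sum => i _; rewrite ler_wpM2r//; case/andP: (ah i).
have [i [y [Gy ->]]] := gasket_split Gx.
rewrite spline_contraction; last exact: gasket_triangle.
by apply: IH => //; exact: sub_boundary_bounds.
Qed.

Lemma spline_dist n d a x j : spread d a -> gasket x -> `|spline n a x - a j| <= d.
Proof.
move=> ad Gx; have : a j - d <= spline n a x <= a j + d.
  apply: spline_bounds => // i; have := ad i j; rewrite ler_norml => /andP[? ?].
  by apply/andP; split; lra.
by move=> /andP[? ?]; rewrite ler_norml; apply/andP; split; lra.
Qed.

Lemma spline_step n d a x : spread d a -> gasket x ->
  `|spline n.+1 a x - spline n a x| <= 2 * d * (3 / 5) ^+ n.
Proof.
elim: n d a x => [|n IH] d a x ad Gx.
  rewrite expr0 mulr1 -(subrKA (a ord0)); apply: le_trans (ler_normD _ _) _.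
  have h1 := spline_dist 1 ord0 ad Gx; have h0 := spline_dist 0 ord0 ad Gx.
  by rewrite (distrC (a ord0)); lra.
have [i [y [Gy ->]]] := gasket_split Gx; have Ty := gasket_triangle Gy.
rewrite !(spline_contraction _ _ _ Ty).
apply: le_trans (IH _ _ _ (sub_boundary_spread i ad) Gy) _.
by rewrite exprS; lra.
Qed.

Definition harmonic a x : R := limn (fun n => spline n a x).

Lemma harmonic_cvg d a x : spread d a -> gasket x ->
  spline n a x @[n --> \oo] --> harmonic a x.
Proof.
move=> ad Gx; have d0 : 0 <= d by apply: le_trans (ad ord0 ord0); rewrite normr_ge0.
(* The correction makes the sequence nonincreasing. *)
pose g n := spline n a x + 5 * d * (3 / 5) ^+ n.
have p0 : (fun n => 5 * d * (3 / 5) ^+ n) @ \oo --> (5 * d * 0).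
  by apply: cvgMr; apply: cvg_expr; rewrite ger0_norm; lra.
have gcv : cvgn g.
  apply: nonincreasing_is_cvgn.
    apply/nonincreasing_seqP => n; rewrite /g exprS.
    (* The correction drops by 5 * d * (1 - 3 / 5) * (3 / 5) ^ n = 2 * d * (3 / 5) ^ n, exactly the
       bound on one step. *)
    have := spline_step n ad Gx; rewrite ler_norml => /andP[_].
    by lra.
  exists (a ord0 - d) => _ [n _ <-]; rewrite /g.
  have := spline_dist n ord0 ad Gx; rewrite ler_norml => /andP[? _].
  have : 0 <= 5 * d * (3 / 5) ^+ n by rewrite !mulr_ge0// exprn_ge0.
  by lra.
have -> : (fun n => spline n a x) = (fun n => g n - 5 * d * (3 / 5) ^+ n).
  by apply/funext => n; rewrite /g addrK.
have cv : (fun n => g n - 5 * d * (3 / 5) ^+ n) @ \oo --> (limn g - 5 * d * 0).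
  by apply: cvgB => //; exact: p0.
rewrite /harmonic.
have -> : (fun n => spline n a x) = (fun n => g n - 5 * d * (3 / 5) ^+ n).
  by apply/funext => n; rewrite /g addrK.
by rewrite (cvg_lim _ cv).
Qed.

Lemma harmonic_vertex a i : harmonic a (vertex i) = a i.
Proof.
rewrite /harmonic; under eq_fun do rewrite spline_vertex.
exact: lim_cst.
Qed.

Lemma harmonic_contraction d a i x : spread d a -> gasket x ->
  harmonic a (contraction i x) = harmonic (sub_boundary i a) x.
Proof.
move=> ad Gx; apply: cvg_lim => //.
rewrite -(cvg_shiftS (fun n => spline n a (contraction i x))) /=.
have -> : (fun n => spline n (sub_boundary (cell_index (contraction i x)) a)
    (contractionV (cell_index (contraction i x)) (contraction i x))) =
    (fun n => spline n (sub_boundary i a) x).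
  by apply/funext => n; exact: (spline_contraction n a i (gasket_triangle Gx)).
exact: harmonic_cvg (sub_boundary_spread i ad) Gx.
Qed.

Lemma harmonic_bounds d a x lo hi : spread d a -> (forall j, lo <= a j <= hi) ->
  gasket x -> lo <= harmonic a x <= hi.
Proof.
move=> ad ah Gx; have cv := harmonic_cvg ad Gx.
apply/andP; split.
  by apply: (cvgr_to_ge cv); apply: nearW => n; case/andP: (spline_bounds n ah Gx).
by apply: (cvgr_to_le cv); apply: nearW => n; case/andP: (spline_bounds n ah Gx).
Qed.

(** Each letter shrinks the spread of the boundary values by 3/5, and on the final cell both values
    lie within one spread of a boundary value. *)
Lemma harmonic_osc d a w x y : spread d a -> gasket x -> gasket y ->
  `|harmonic a (word_map w x) - harmonic a (word_map w y)| <= 2 * (3 / 5) ^+ size w * d.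
Proof.
elim: w d a => [|i w IH] d a ad Gx Gy /=.
  have h z : gasket z -> `|harmonic a z - a ord0| <= d.
    move=> Gz; have : a ord0 - d <= harmonic a z <= a ord0 + d.
      apply: (harmonic_bounds ad _ Gz) => j.
      have := ad j ord0; rewrite ler_norml => /andP[? ?].
      by apply/andP; split; lra.
    by move=> /andP[? ?]; rewrite ler_norml; apply/andP; split; lra.
  rewrite -(subrKA (a ord0)); apply: le_trans (ler_normD _ _) _.
  by rewrite (distrC (a ord0)) expr0; have := h _ Gx; have := h _ Gy; lra.
rewrite !(harmonic_contraction i ad) ?gasket_word_map//; try exact: gasket_word_map.
apply: le_trans (IH _ _ (sub_boundary_spread i ad) Gx Gy) _.
by rewrite exprS; lra.
Qed.

Lemma eq_cell_energy m f g : (forall x, gasket x -> f x = g x) ->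
  cell_energy m f = cell_energy m g.
Proof.
elim: m f g => [|m IH] f g fg /=.
  congr (_ * _); apply: eq_bigr => i _; apply: eq_bigr => j _.
  by rewrite !fg//; exact: gasket_vertex.
congr (_ * _); apply: eq_bigr => i _; apply: IH => x Gx.
by rewrite /= fg//; exact: gasket_contraction.
Qed.

Lemma cell_energy_harmonic m d a : spread d a ->
  cell_energy m (harmonic a) = boundary_energy a.
Proof.
elim: m d a => [|m IH] d a ad /=.
  congr (_ * _); apply: eq_bigr => i _; apply: eq_bigr => j _.
  by rewrite !harmonic_vertex.
rewrite -sub_boundary_energy; congr (_ * _); apply: eq_bigr => i _.
rewrite -(IH _ _ (sub_boundary_spread i ad)); apply: eq_cell_energy => x Gx.
exact: harmonic_contraction ad Gx.
Qed.

Lemma energy_harmonic d a u : spread d a -> (forall x, gasket x -> u x = harmonic a x) ->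
  energy u = (boundary_energy a)%:E.
Proof.
move=> ad ua; rewrite -(cvg_lim _ (@energy_cvg _ u))//.
under eq_fun do rewrite (eq_cell_energy _ ua) (cell_energy_harmonic _ ad).
exact: lim_cst.
Qed.

End Harmonic.

(** * Test functions *)

Section Tent.
Context {R : realType}.
Implicit Types (x y : R * R) (i j : 'I_3) (w v : seq 'I_3) (e : bool).

(** If the first letters i and j differed, x would be both [vertex j] and [vertex i]. This serves to
    count the cells whose i-th vertex is a prescribed point. *)
Lemma word_map_eq_word w v x : size w = size v -> triangle x ->
  word_map w x = word_map v x -> w = v.
Proof.
move=> + Tx; elim: w v => [|i w IH] [|j v]//= [sz].
have [<- /contraction_inj/(IH _ sz) -> //|ij E] := eqVneq i j.
have Tw := triangle_word_map w Tx; have Tv := triangle_word_map v Tx.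
have xj := word_map_vertex_inv Tx (contraction_meet ij Tw Tv E).
have ji : j != i by rewrite eq_sym.
have xi := word_map_vertex_inv Tx (contraction_meet ji Tv Tw (esym E)).
by move: ij; rewrite (@vertex_inj R i j) ?eqxx// -xi.
Qed.

Lemma boundary_energy01 (a : 'I_3 -> R) : (forall i, a i = 0 \/ a i = 1) ->
  boundary_energy a <= 3 * \sum_i a i.
Proof.
move=> a01; rewrite /boundary_energy !big_I3/=.
have h i : a i ^+ 2 = a i by case: (a01 i) => ->; rewrite ?expr0n ?expr1n.
have p i : 0 <= a i by case: (a01 i) => ->.
move: (h (@Ordinal 3 0 isT)) (h (@Ordinal 3 1 isT)) (h (@Ordinal 3 2 isT)).
move: (p (@Ordinal 3 0 isT)) (p (@Ordinal 3 1 isT)) (p (@Ordinal 3 2 isT)).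
move: (a _) (a _) (a _) => b c d *; nra.
Qed.

Variables (e0 : bool) (k0 : nat) (w0 : seq 'I_3).

(** Equality of k - size w and k0 - size w0, written without subtraction since these may be
    negative. *)
Definition same_level (k : nat) w := (k + size w0 = k0 + size w)%N.

Definition tent_boundary (t : R * R -> R * R) : 'I_3 -> R :=
  fun i => (`[< exists j, t (vertex i) = tile e0 k0 w0 (vertex j) >] : bool)%:R.

(* The choice of a cell containing x is irrelevant, see tent_tile. *)
Definition tent x : R :=
  let z := xget (e0, k0, w0)
    [set z : bool * nat * seq 'I_3 | same_level z.1.2 z.2 /\ cell z.1.1 z.1.2 z.2 x] in
  harmonic (tent_boundary (tile z.1.1 z.1.2 z.2)) (tileV z.1.1 z.1.2 z.2 x).

Lemma tent_boundary01 t i : tent_boundary t i = 0 \/ tent_boundary t i = 1.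
Proof. by rewrite /tent_boundary; case: asboolP; [right|left]. Qed.

Lemma tent_boundary_spread t : spread 1 (tent_boundary t).
Proof.
move=> i j; have [->|->] := tent_boundary01 t i;
  have [->|->] := tent_boundary01 t j;
  by rewrite ?subrr ?normr0 ?subr0 ?sub0r ?normrN ?normr1.
Qed.

(** Padded to the common scale k + k', two cells of the level through the same point either coincide
    or meet at a vertex of both. There the values agree, because the boundary value depends only on
    the location of the vertex. *)
Lemma tent_tile e k w y : same_level k w -> gasket y ->
  tent (tile e k w y) = harmonic (tent_boundary (tile e k w)) y.
Proof.
move=> lkw Gy; rewrite /tent; set z := xget _ _.
have : [set z : bool * nat * seq 'I_3 | same_level z.1.2 z.2 /\
    cell z.1.1 z.1.2 z.2 (tile e k w y)] z.
  by rewrite /z; apply: xgetPex; exists (e, k, w); split => //; exists y.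
move: z => [[e' k'] w'] [/= lkw' [y' Gy' E]].
rewrite -E tileK.
have pE : tile e' k' w' = tile e' (k + k') (nseq k ord0 ++ w') :> (R * R -> R * R).
  by rewrite (tile_padn k) addnC.
have pE2 : tile e k w = tile e (k + k') (nseq k' ord0 ++ w) :> (R * R -> R * R).
  exact: tile_padn.
have sz : size (nseq k ord0 ++ w') = size (nseq k' (ord0 : 'I_3) ++ w).
  move: lkw lkw'; rewrite /same_level !size_cat !size_nseq; lia.
have [[ee' ww']|ne] := eqVneq (e', nseq k ord0 ++ w') (e, nseq k' ord0 ++ w).
  have tE : tile e' k' w' = tile e k w :> (R * R -> R * R) by rewrite pE pE2 ee' ww'.
  rewrite tE; congr harmonic; apply: (can_inj (tileK e k w)).
  by rewrite -E tE.
rewrite pE pE2 in E *.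
have [i iP] := @tile_meet R _ _ (k + k') _ _ sz ne.
have ne' : (e, nseq k' ord0 ++ w) != (e', nseq k ord0 ++ w') by rewrite eq_sym.
have [j jP] := @tile_meet R _ _ (k + k') _ _ (esym sz) ne'.
have Ty := gasket_triangle Gy; have Ty' := gasket_triangle Gy'.
move: (E) => E'; rewrite (iP _ _ Ty' Ty E) (jP _ _ Ty Ty' (esym E)) in E' *.
by rewrite !harmonic_vertex /tent_boundary E'.
Qed.

Lemma tent_bounds e k w y : same_level k w -> gasket y ->
  0 <= tent (tile e k w y) <= 1.
Proof.
move=> lkw Gy; rewrite tent_tile//.
apply: (harmonic_bounds (@tent_boundary_spread _) _ Gy) => i.
by case: (tent_boundary01 (tile e k w) i) => ->; rewrite lexx ler01.
Qed.

Lemma tent_base x : cell e0 k0 w0 x -> tent x = 1.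
Proof.
move=> [y Gy <-]; rewrite tent_tile//.
have b1 i : tent_boundary (tile e0 k0 w0) i = 1.
  by rewrite /tent_boundary; case: asboolP => // -[]; exists i.
have /andP[h1 h2] : 1 <= harmonic (tent_boundary (tile e0 k0 w0)) y <= 1.
  by apply: (harmonic_bounds (@tent_boundary_spread _) _ Gy) => i; rewrite b1 lexx.
by apply/eqP; rewrite eq_le h1 h2.
Qed.

Lemma same_levelE (K n : nat) w : (k0 <= K)%N -> size w = (K - k0 + size w0)%N ->
  same_level K w.
Proof. by rewrite /same_level => kK ->; lia. Qed.

(** The bound by [ell] keeps nearby points in one exhaustion set, which has finitely many subcells
    of depth d. Those missing x form a closed set, so a nearby point shares a subcell with x, and
    there the oscillation is below eps by [harmonic_osc]. *)
Lemma tent_continuous : {within hgasket, continuous tent}.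
Proof.
apply/within_continuousP => x hx eps eps0.
have [K [kK xK]] : exists K, (k0 <= K)%N /\ `|ell x| < 2 ^+ K.
  have [n nP] : exists n : nat, `|ell x| < n%:R.
    by exists (Num.truncn `|ell x|).+1; exact: truncnS_gt.
  exists (k0 + n)%N; split; first exact: leq_addr.
  apply: lt_le_trans nP _; rewrite -natrX ler_nat.
  by apply: leq_trans (ltnW (ltn_expl n (ltnSn 1))) _; rewrite leq_exp2l// leq_addl.
have [d dP] : exists d, 2 * (3 / 5 : R) ^+ d < eps.
  have : 2 * (3 / 5 : R) ^+ d @[d --> \oo] --> (2 * 0 : R).
    by apply: cvgMr; apply: cvg_expr; rewrite ger0_norm; lra.
  rewrite mulr0 => /cvgrPdist_lt/(_ _ eps0)[d _ h]; exists d.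
  by have := h d (leqnn d); rewrite sub0r normrN ger0_norm// mulr_ge0// exprn_ge0.
pose n := (K - k0 + size w0)%N.
pose C := \bigcup_(z in [set z : bool * (n + d).-tuple 'I_3 | ~ cell z.1 K z.2 x])
  cell z.1 K z.2 : set (R * R).
have cC : closed C.
  apply: closed_bigcup => [|z _]; first exact: finite_finset.
  exact: closed_cell.
have nC : nbhs x (~` C).
  by apply: open_nbhs_nbhs; split; [exact: closed_openC|move=> [z /= nz /nz]].
have nK : nbhs x [set y | `|ell y| < 2 ^+ K].
  apply: open_nbhs_nbhs; split => //=.
  apply: (@open_comp _ _ (fun y : R * R => `|ell y|) [set t | t < 2 ^+ K]); last exact: open_lt.
  move=> y _; apply: (@continuous_comp _ _ _ (@ell R) (fun t : R => `|t|)).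
    exact: ell_continuous.
  exact: norm_continuous.
apply: filterS2 nC nK => y nCy yK hy.
have [e [w [sw cy]]] := exhaustion_split (n + d) (ell_exhaustion hy yK).
have cx : cell e K w x.
  apply: contrapT => ncx; apply: nCy; exists (e, tcast sw (in_tuple w)) => /=;
    by rewrite val_tcast.
move: cx cy; rewrite -(cat_take_drop n w) => -[x' Gx <-] [y' Gy <-].
have sl : same_level K (take n w).
  by apply: same_levelE => //; rewrite size_take_min sw; apply/minn_idPl; rewrite leq_addr.
rewrite !tile_cat !tent_tile//; try exact: gasket_word_map.
apply: le_lt_trans dP.
apply: le_trans (harmonic_osc _ (@tent_boundary_spread _) Gx Gy) _.
by rewrite size_drop sw addKn mulr1.
Qed.

(** For each sign and each pair i, j, at most one word places its i-th vertex at the j-th vertex of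
    the base cell; hence 18 = 2 * 3 * 3. *)
Lemma sum_tent_boundary_le K : (k0 <= K)%N ->
  \sum_(z : bool * (K - k0 + size w0).-tuple 'I_3)
    \sum_i tent_boundary (tile z.1 K z.2) i <= 18.
Proof.
move=> kK; set n := (K - k0 + size w0)%N.
pose B (e : bool) (i j : 'I_3) (w : seq 'I_3) : R :=
  (@tile R e K w (vertex i) == tile e0 k0 w0 (vertex j))%:R.
have h0 : \sum_(z : bool * n.-tuple 'I_3) \sum_i tent_boundary (tile z.1 K z.2) i <=
    \sum_(e : bool) \sum_(w : n.-tuple 'I_3) \sum_i \sum_j B e i j w.
  rewrite [leRHS]pair_big/=; apply: ler_sum => -[e w] _; apply: ler_sum => i _ /=.
  rewrite /tent_boundary; case: asboolP => [[j E]|_]; last first.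
    by apply: sumr_ge0 => j _; rewrite /B ler0n.
  by rewrite (bigD1 j)//= {1}/B E eqxx lerDl sumr_ge0// => l _; rewrite /B ler0n.
apply: le_trans h0 _.
have h e i j : \sum_(w : n.-tuple 'I_3) B e i j w <= 1.
  have [[w wP]|nw] := pselect (exists w : n.-tuple 'I_3,
      @tile R e K w (vertex i) = tile e0 k0 w0 (vertex j)).
    rewrite (bigD1 w)//= /B wP eqxx big1 ?addr0// => v vw.
    case: eqP => // vP; exfalso; move/eqP: vw; apply; apply/val_inj.
    have sz : size v = size w by rewrite !size_tuple.
    apply: (word_map_eq_word sz (triangle_vertex i)).
    have := etrans vP (esym wP) => /(congr1 (scale ((-1) ^+ e * 2 ^+ K)^-1)).
    by rewrite /tile !scaleA mulVf ?tile_coef_neq0// !scale1.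
  rewrite big1 ?ler01// => w _; rewrite /B; case: eqP => // E.
  by exfalso; apply: nw; exists w.
apply: (@le_trans _ _ (\sum_(e : bool) \sum_(i < 3) \sum_(j < 3) 1)); last first.
  by rewrite big_bool/= !sumr_const !card_ord -!mulrnA -natrD ler_nat.
apply: ler_sum => e _; rewrite exchange_big/=; apply: ler_sum => i _.
by rewrite exchange_big/=; apply: ler_sum => j _.
Qed.

(** The function is harmonic on each cell of its level, with boundary values 0 and 1, whose energy
    is at most 3 times their sum; hence 54 = 3 * 18. *)
Lemma henergy_tent :
  (henergy tent <= (54 * ((3 / 5) ^+ k0 * (5 / 3) ^+ size w0))%:E)%E.
Proof.
apply: (@henergy_le _ k0) => K kK; set n := (K - k0 + size w0)%N.
have -> : tile_energy K K tent =
    (((3 / 5) ^+ k0 * (5 / 3) ^+ size w0)%:E * tile_energy K n tent)%E.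
  rewrite (tile_energyE K K) (tile_energyE K n) muleA -EFinM; congr (_%:E * _)%E.
  rewrite /n exprD -[in LHS](subnKC kK) exprD -mulrA; congr (_ * _).
  rewrite mulrCA -exprMn (_ : 5 / 3 * (3 / 5) = 1) ?expr1n ?mulr1//; lra.
rewrite [X in (_ <= X%:E)%E]mulrC [leRHS]EFinM; apply: lee_wpmul2l.
  by rewrite lee_fin mulr_ge0// exprn_ge0.
rewrite /tile_energy pair_big/=.
apply: (@le_trans _ _ (\sum_(z : bool * n.-tuple 'I_3)
   (3 * \sum_i tent_boundary (tile z.1 K z.2) i)%:E)%E).
  apply: lee_sum => -[e w] _ /=.
  rewrite (@energy_harmonic _ 1 (tent_boundary (tile e K w))).
  - by rewrite lee_fin; apply: boundary_energy01; exact: tent_boundary01.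
  - exact: tent_boundary_spread.
  - by move=> x Gx; rewrite /= tent_tile//; apply: same_levelE => //; rewrite size_tuple.
rewrite sumEFin lee_fin -mulr_sumr.
have := sum_tent_boundary_le kK; rewrite -/n; lra.
Qed.

Variables (nu : probability (R * R)%type R)
  (hnu : {measure set (R * R)%type -> \bar R}).
Hypotheses (nuP : is_gasket_measure nu) (hnuP : is_hgasket_measure nu hnu).

Lemma hLnorm_tent (p : \bar R) : (1 <= p)%E ->
  (hLnorm hnu p tent <= (18 * (3 ^+ k0 / 3 ^+ size w0) `^ rinv p)%:E)%E.
Proof.
have s0 : 0 < 3 ^+ k0 / 3 ^+ size w0 :> R by exact: cell_scale_gt0.
have tent01 x : hgasket x -> 0 <= tent x <= 1.
  rewrite hgasket_exhaustion => -[a _ ax].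
  have /(exhaustion_split (a + size w0))[e [w [sw [y Gy <-]]]] : exhaustion (k0 + a) x.
    by apply: exhaustion_mono ax; rewrite leq_addl.
  by apply: tent_bounds => //; rewrite /same_level sw; lia.
case: p => [r||]//= r1; last first.
  rewrite rinvy powRr0 mulr1 /hLnorm unlock; case: ifP => _; last by rewrite lee_fin.
  apply/ess_supP; apply: aeW => x /=; rewrite lee_fin /patch.
  case: ifPn => [/set_mem/tent01/andP[t0 t1]|_]; last by rewrite normr0.
  by rewrite ger0_norm//; lra.
have {}r1 : 1 <= r by rewrite -lee_fin.
have r0 : 0 < r by lra.
rewrite rinvE//; apply/hLnorm_le => //.
rewrite powRM ?powR_ge0// -powRrM mulVf ?gt_eqF// powRr1 ?(ltW s0)//.
apply: (@le_trans _ _ (18 * (3 ^+ k0 / 3 ^+ size w0))%:E); last first.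
  rewrite lee_fin ler_pM2r//; apply: le1r_powR => //.
  by rewrite ler1n.
pose f x : \bar R := (`|(tent \_ hgasket) x| `^ r)%:E.
have -> : (\int[hnu]_x (`|(tent \_ hgasket) x| `^ r)%:E = \int[hnu]_(x in hgasket) f x)%E.
  rewrite [RHS]integral_mkcond; apply: eq_integral => x _.
  rewrite /f /patch; case: ifPn => // _.
  by rewrite normr0 powR0// gt_eqF.
have mf : measurable_fun setT f by apply: measurable_powRfun; exact: tent_continuous.
have f0 x : (0 <= f x)%E by rewrite lee_fin powR_ge0.
apply: (@integral_hgasket_le _ _ _ k0) => //; first exact: measurable_funTS.
move=> K kK; set n := (K - k0 + size w0)%N.
(* The sum of the boundary values dominates the r-th power of the function on the cell: it is at
   least 1 unless all of them vanish, and then the function vanishes there by the maximum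
   principle. *)
pose c (z : bool * n.-tuple 'I_3) : R := \sum_i tent_boundary (tile z.1 K z.2) i.
have b0 t i : 0 <= tent_boundary t i by case: (tent_boundary01 t i) => ->.
have c0 z : 0 <= c z by apply: sumr_ge0.
apply: le_trans (@integral_le_cover _ _ _ hnu _
  (fun z : bool * n.-tuple 'I_3 => cell z.1 K z.2) _ _ f c _ _ _ _ _) _ => //.
- by move=> z; exact: measurable_cell.
- exact: measurable_exhaustion.
- exact: measurable_funTS.
- move=> x /(exhaustion_split n)[e [w [sw cx]]].
  pose z := (e, tcast sw (in_tuple w)); exists z.
  have cz : cell z.1 K z.2 x by rewrite /z /= val_tcast.
  split => //; rewrite /f /patch mem_set; last exact: cell_hgasket cx.
  have sl : same_level K z.2 by apply: same_levelE => //; rewrite size_tuple.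
  have /andP[t0 t1] : 0 <= tent x <= 1 by apply: tent01; exact: cell_hgasket cx.
  rewrite lee_fin ger0_norm//; move: (cz) => [y Gy yE].
  have [bz|/existsNP[i bi]] := pselect (forall i, tent_boundary (tile z.1 K z.2) i = 0).
    have /andP[h1 h2] : 0 <= tent x <= 0.
      rewrite -yE tent_tile//.
      by apply: (harmonic_bounds (@tent_boundary_spread _) _ Gy) => i; rewrite bz lexx.
    have -> : tent x = 0 by apply/eqP; rewrite eq_le h2 h1.
    by rewrite powR0 ?gt_eqF.
  apply: (@le_trans _ _ 1).
    apply: (@le_trans _ _ (1 `^ r)); last by rewrite powR1.
    by rewrite ge0_ler_powR ?nnegrE// ltW.
  have [//|b1] := tent_boundary01 (tile z.1 K z.2) i.
  by rewrite /c (bigD1 i)//= b1 lerDl sumr_ge0.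
apply: (@le_trans _ _ (\sum_(z : bool * n.-tuple 'I_3) (c z * (3 ^+ k0 / 3 ^+ size w0))%:E)%E).
  apply: lee_sum => z _; rewrite (measure_cell nuP hnuP) size_tuple -EFinM.
  suff -> : 3 ^+ K / 3 ^+ n = 3 ^+ k0 / 3 ^+ size w0 :> R by [].
  pose m := (K - k0)%N; have KE : K = (k0 + m)%N by rewrite subnKC.
  have nE : n = (size w0 + m)%N by rewrite /n addnC.
  by rewrite nE [X in 3 ^+ X / _ = _]KE cell_scaleD.
rewrite sumEFin lee_fin -mulr_suml ler_pM2r//; exact: sum_tent_boundary_le.
Qed.

Lemma form_domain_tent : form_domain hnu tent.
Proof.
have ct := tent_continuous; split => //; exists (fun=> tent); split.
- move=> _; split => //.
    by apply: le_lt_trans (hLnorm_tent _) _; rewrite ?lee_fin ?ler1n ?ltry.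
  by apply: le_lt_trans henergy_tent _; rewrite ltry.
- move=> eps eps0; exists 0%N => m n _ _.
  have -> : (tent \- tent)%R = (fun=> 0) by apply/funext => x /=; rewrite subrr.
  rewrite /form_norm (_ : henergy _ = 0%E).
    rewrite poweR0r// add0e /hLnorm.
    have -> : EFin \o (fun=> 0 : R) \_ hgasket = cst 0%E :> (R * R -> \bar R).
      by apply/funext => x /=; rewrite /patch if_same.
    by rewrite Lnorm0// lte_fin.
  apply: esum1 => t _; apply/eqP; rewrite eq_le energy_ge0 andbT.
  apply: energy_le => k; rewrite lee_fin cell_energyE.
  rewrite big1 ?mulr0// => w _; rewrite big1// => i _; rewrite big1// => j _.
  by rewrite /= subrr expr0n.
- by move=> x _; exact: cvg_cst.
Qed.

(** Positivity of [sigma] on the cell matters for q = oo: the left side is then 1 by the convention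
    for the power 0, and the norm is at least 1 because the cell is not null. *)
Lemma hLnorm_tent_ge (sigma : {measure set (R * R)%type -> \bar R}) (q : \bar R) :
  (1 <= q)%E -> (0 < sigma (cell e0 k0 w0))%E ->
  (sigma (cell e0 k0 w0) `^ rinv q <= hLnorm sigma q tent)%E.
Proof.
move=> q1 s0; case: q q1 => [r||]//= r1; last first.
  rewrite rinvy poweRe0 /hLnorm unlock; case: ifPn => sT; last first.
    exfalso; move/negP: sT; apply; apply: lt_le_trans s0 _.
    by apply: measure_mono => //; exact: measurable_cell.
  rewrite leNgt; apply/negP => /[dup] h _.
  have /ess_supP[N [mN N0 sN]] : (ess_sup sigma (abse \o (EFin \o tent \_ hgasket)) <=
    ess_sup sigma (abse \o (EFin \o tent \_ hgasket)))%E by [].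
  suff : (sigma (cell e0 k0 w0) <= 0)%E by rewrite leNgt s0.
  rewrite -N0; apply: measure_mono => //; first exact: measurable_cell.
  move=> x cx; apply: sN => /=; apply/negP; rewrite -ltNge; apply: lt_le_trans h _.
  rewrite /patch mem_set; last exact: cell_hgasket cx.
  by rewrite tent_base// normr1.
have {}r1 : 1 <= r by rewrite -lee_fin.
have r0 : 0 < r by lra.
rewrite rinvE// hLnormE; apply: gt0_ler_poweR; first by rewrite invr_ge0 ltW.
- by rewrite in_itv/= leey measure_ge0.
- by rewrite in_itv/= leey andbT; apply: integral_ge0 => x _; rewrite lee_fin powR_ge0.
have mf := measurable_powRfun r tent_continuous.
apply: (@le_trans _ _ (\int[sigma]_(x in cell e0 k0 w0) (`|(tent \_ hgasket) x| `^ r)%:E)%E).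
  rewrite -[leLHS]mul1e -integral_cst; last exact: measurable_cell.
  apply: ge0_le_integral => //; first exact: measurable_cell.
  - exact: measurable_funTS.
  - move=> x cx; rewrite /patch mem_set; last exact: cell_hgasket cx.
    by rewrite tent_base// normr1 powR1.
apply: ge0_subset_integral => //; first exact: measurable_cell.
Qed.

End Tent.

(** * Optimality of the exponents *)

Section Optimality.
Context {R : realType}.
Implicit Types (u : R * R -> R) (w : seq 'I_3).
Variables (nu : probability (R * R)%type R)
  (hnu : {measure set (R * R)%type -> \bar R}).
Hypotheses (nuP : is_gasket_measure nu) (hnuP : is_hgasket_measure nu hnu).

Lemma powR_scaled_le (c r t : R) : 1 <= c -> 0 <= r <= 1 ->
  (c * expR t) `^ r <= c * expR (t * r).
Proof.
move=> c1 /andP[r0 r1]; rewrite powRM ?expR_ge0//; last by lra.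
by rewrite -expRM ler_pM2r ?expR_gt0// ler1_powR.
Qed.

(** With s = expR T, the energy contributes s^(- b inv_delta_s / 2) and the norm s^((1 - b) / p);
    constants raised to powers in [0, 1] do not grow. *)
Lemma sobolev_term_tent (p : \bar R) e k w (b : R) : (1 <= p)%E -> 0 <= b <= 1 ->
  (sobolev_term hnu p b (tent e k w) <=
    ((54 * 18) * expR ((k%:R - (size w)%:R) * ln 3 *
       (rinv p - b * (rinv p + inv_delta_s / 2))))%:E)%E.
Proof.
move=> p1 /andP[b0 b1]; set T := _ * ln 3.
have hE := @henergy_tent R e k w; have hL := hLnorm_tent e k w nuP hnuP p1.
have sE : 3 ^+ k / 3 ^+ size w = expR T by rewrite cell_scale_expR.
have eE : (3 / 5) ^+ k * (5 / 3) ^+ size w = expR (- T * inv_delta_s).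
  by rewrite mulrC energy_scale_expR -opprB mulNr.
rewrite eE in hE; rewrite sE -expRM in hL.
have b2 : 0 <= b / 2 <= 1 by apply/andP; split; lra.
have b3 : 0 <= 1 - b <= 1 by apply/andP; split; lra.
have h1 : (henergy (tent e k w) `^ (b / 2) <=
    (54 * expR (- T * inv_delta_s * (b / 2)))%:E)%E.
  apply: le_trans (_ : (_ <= (54 * expR (- T * inv_delta_s))%:E `^ (b / 2))%E) _.
    apply: gt0_ler_poweR => //; first by case/andP: b2.
    - by rewrite in_itv/= leey henergy_ge0.
    - by rewrite in_itv/= leey andbT lee_fin mulr_ge0 ?expR_ge0.
  by rewrite poweR_EFin lee_fin; apply: powR_scaled_le => //; rewrite ler1n.
have h2 : (hLnorm hnu p (tent e k w) `^ (1 - b) <=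
    (18 * expR (T * rinv p * (1 - b)))%:E)%E.
  apply: le_trans (_ : (_ <= (18 * expR (T * rinv p))%:E `^ (1 - b))%E) _.
    apply: gt0_ler_poweR => //; first by case/andP: b3.
    - by rewrite in_itv/= leey Lnorm_ge0.
    - by rewrite in_itv/= leey andbT lee_fin mulr_ge0 ?expR_ge0.
  by rewrite poweR_EFin lee_fin; apply: powR_scaled_le => //; rewrite ler1n.
apply: le_trans (lee_pmul (poweR_ge0 _ _) (poweR_ge0 _ _) h1 h2) _.
rewrite -EFinM lee_fin mulrACA -expRD ler_wpM2l// ler_expR le_eqVlt.
by apply/orP; left; apply/eqP; ring.
Qed.

(** The logarithm of the assumed inequality on a test function, all b_i being replaced by the
    dominant exponent [bet]: the smallest when T > 0, the largest when T < 0. *)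
Lemma tent_inequality (p q : \bar R) (sigma : {measure set (R * R)%type -> \bar R})
    (N : nat) (b : 'I_N -> R) (C v bet : R) e k w :
  let T := (k%:R - (size w)%:R) * ln 3 in
  let kap := rinv p + inv_delta_s / 2 in
  (1 <= p)%E -> (1 <= q)%E -> (0 < N)%N -> (forall i, 0 <= b i <= 1) -> 0 < C ->
  (forall u, form_domain hnu u ->
    (hLnorm sigma q u <= C%:E * \sum_(i < N) sobolev_term hnu p (b i) u)%E) ->
  sigma (cell e k w) = v%:E -> 0 < v ->
  (forall i, T * (rinv p - b i * kap) <= T * (rinv p - bet * kap)) ->
  rinv q * ln v <= ln (C * (N%:R * (54 * 18))) + T * (rinv p - bet * kap).
Proof.
move=> T kap p1 q1 N0 b01 C0 ineq sv v0 Tb.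
have sig0 : (0 < sigma (cell e k w))%E by rewrite sv lte_fin.
have h := le_trans (hLnorm_tent_ge q1 sig0) (ineq _ (form_domain_tent e k w nuP hnuP)).
have {}h : ((v `^ rinv q)%:E <= (C * (N%:R * ((54 * 18) * expR (T * (rinv p - bet * kap)))))%:E)%E.
  rewrite -poweR_EFin -sv; apply: le_trans h _.
  rewrite [leRHS]EFinM; apply: lee_wpmul2l; first by rewrite lee_fin ltW.
  apply: (@le_trans _ _ (\sum_(i < N) ((54 * 18) * expR (T * (rinv p - bet * kap)))%:E)%E).
    apply: lee_sum => i _; apply: le_trans (sobolev_term_tent e k w p1 (b01 i)) _.
    by rewrite lee_fin ler_pM2l// ler_expR; exact: Tb.
  by rewrite sumEFin sumr_const card_ord lee_fin -[leLHS]mulr_natl lexx.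
have N0' : 0 < N%:R :> R by rewrite ltr0n.
move: h; rewrite lee_fin => h; rewrite -ln_powR -[X in _ + X]expRK -lnM ?posrE ?expR_gt0//.
  rewrite ler_ln ?posrE ?powR_gt0//; last by rewrite !mulr_gt0 ?expR_gt0.
  by move: h; rewrite !mulrA.
by rewrite !mulr_gt0.
Qed.

(** Division by T makes the constant D disappear in the limit; this is what renders the optimality
    independent of the constant in the inequality. *)
Lemma limit_slope (x T : R^nat) (c D bet : R) : x @ \oo --> c ->
  (forall M, \forall n \near \oo, M < T n) ->
  (\forall n \near \oo, x n * T n <= D + T n * bet) -> c <= bet.
Proof.
move=> xc Toy h; rewrite leNgt; apply/negP => bc.
pose eta := (c - bet) / 2; have eta0 : 0 < eta by rewrite /eta; lra.
have h1 : \forall n \near \oo, bet + eta < x n.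
  by apply: (cvgr_gt _ xc); rewrite /eta; lra.
near \oo => n.
have T0 : 0 < T n by near: n; exact: Toy.
have TD : D / eta < T n by near: n; exact: Toy.
have xn : bet + eta < x n by near: n.
have : x n * T n <= D + T n * bet by near: n.
apply/negP; rewrite -ltNge.
have : (bet + eta) * T n < x n * T n by rewrite ltr_pM2r.
by move: TD; rewrite ltr_pdivrMr//; lra.
Unshelve. all: by end_near. Qed.

(** T is the logarithm of the Hausdorff measure of A, the common parameter of diameters and
    logarithmic ratios. *)
Definition cell_level (A : set (R * R)) (T : R) :=
  exists e k w, A = cell e k w /\ T = (k%:R - (size w)%:R) * ln 3.

Lemma ln2_gt0 : 0 < ln 2 :> R. Proof. by rewrite ln_gt0// ltr1n. Qed.

Lemma diam_level A T : cell_level A T -> diam A = (expR (T / ln 3 * ln 2))%:E.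
Proof.
move=> [e [k [w [-> ->]]]]; rewrite diam_cell mulfK ?gt_eqF ?ln3_gt0//.
by rewrite mulrBl expRD expRN !expR_nat_ln.
Qed.

Lemma level_to_pinfty (A : nat -> set (R * R)) (T : R^nat) :
  (forall n, cell_level (A n) (T n)) -> diam (A n) @[n --> \oo] --> +oo%E ->
  forall M, \forall n \near \oo, M < T n.
Proof.
move=> AT /cvgey_gtr h M.
have := h (expR (M / ln 3 * ln 2)) (num_real _); apply: filterS => n.
rewrite (diam_level (AT n)) lte_fin ltr_expR ltr_pM2r ?ln2_gt0//.
by rewrite ltr_pM2r// invr_gt0 ln3_gt0.
Qed.

Lemma level_to_ninfty (A : nat -> set (R * R)) (T : R^nat) :
  (forall n, cell_level (A n) (T n)) -> diam (A n) @[n --> \oo] --> 0%E ->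
  forall M, \forall n \near \oo, M < - T n.
Proof.
move=> AT /fine_cvgP[_ /cvgrPdist_lt h] M.
have := h (expR (- M / ln 3 * ln 2)) (expR_gt0 _); apply: filterS => n.
rewrite /= (diam_level (AT n)) sub0r normrN ger0_norm ?expR_ge0//=.
rewrite ltr_expR ltr_pM2r ?ln2_gt0// ltr_pM2r ?invr_gt0 ?ln3_gt0//.
by rewrite ltrNr.
Qed.

(** A finite ratio excludes measure 0, where [lne] is -oo, and the growth bound excludes +oo. The
    divisor is T itself, whence the condition T != 0. *)
Lemma log_ratio_fin (sigma : {measure set (R * R)%type -> \bar R}) A T (G : R) :
  cell_level A T -> T != 0 -> (sigma A <= G%:E)%E ->
  log_ratio hnu sigma A \is a fin_num ->
  exists v, [/\ sigma A = v%:E, 0 < v & fine (log_ratio hnu sigma A) * T = ln v].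
Proof.
move=> [e [k [w [-> TE]]]] T0 sG; rewrite /log_ratio (measure_cell nuP hnuP).
rewrite cell_scale_expR -TE lne_EFin ?expR_gt0// expRK inver (negbTE T0).
have : (0 <= sigma (cell e k w))%E by exact: measure_ge0.
case: (sigma (cell e k w)) sG => [v||]//= vG v0.
move: v0; rewrite lee_fin le_eqVlt => /predU1P[<-|v0].
  rewrite lexx; have /orP[Tn|Tp] : (T < 0) || (0 < T) by rewrite -neq_lt.
  - by rewrite lt0_mulNye// lte_fin invr_lt0.
  - by rewrite gt0_mulNye// lte_fin invr_gt0.
by rewrite leNgt v0/= => _; exists v; split => //; rewrite mulfVK.
Qed.

Lemma optimality (C0 : R) (p q dlow dup : \bar R)
  (sigma : {measure set (R * R)%type -> \bar R}) :
  (1 <= p)%E -> (p <= q)%E -> (0 < dlow)%E -> (dlow <= dup)%E -> (1 <= dup)%E ->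
  dyadic_growth hnu sigma C0 dlow dup ->
  forall S : int -> set (R * R),
  (forall m : int, dyadic_triangle (S m)) ->
  diam (S (- n%:Z)) @[n --> \oo] --> 0%E ->
  diam (S n%:Z) @[n --> \oo] --> +oo%E ->
  log_ratio hnu sigma (S (- n%:Z)) @[n --> \oo] --> (dup^-1)%E ->
  log_ratio hnu sigma (S n%:Z) @[n --> \oo] --> (dlow^-1)%E ->
  forall (N : nat) (b : 'I_N -> R) (C : R),
  (0 < N)%N -> (forall i : 'I_N, 0 <= b i <= 1) -> 0 < C ->
  (forall u, form_domain hnu u ->
     (hLnorm sigma q u <= C%:E * \sum_(i < N) sobolev_term hnu p (b i) u)%E) ->
  [/\ \big[Num.min/1]_(i < N) b i <= sobolev_exponent p q dlow,
      sobolev_exponent p q dlow <= sobolev_exponent p q dup &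
      sobolev_exponent p q dup <= \big[Num.max/0]_(i < N) b i].
Proof.
move=> p1 pq dl0 dlu du1 gr S Sd dS0 dSy Ldup Ldlow N b C N0 b01 C00 ineq.
have q1 : (1 <= q)%E := le_trans p1 pq.
have dup0 : (0 < dup)%E := lt_le_trans dl0 dlu.
have k0 := sobolev_denominator_gt0 p1.
(* The limits are finite even when an exponent is +oo, so the ratios are eventually finite and the
   cells eventually have positive measure. *)
have finV (d : \bar R) : (0 < d)%E -> (d^-1 = (rinv d)%:E)%E.
  case: d => [d||]; rewrite ?rinvy ?invey//.
  by rewrite lte_fin => d0; rewrite rinvE// inver gt_eqF.
rewrite (finV _ dup0) in Ldup; rewrite (finV _ dl0) in Ldlow.
have /choice[T TP] : forall m : int, exists T, cell_level (S m) T.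
  by move=> m; have /dyadic_cellP[e [k [w ->]]] := Sd m; eexists; exists e, k, w.
have fin_sigma m : exists G : R, (sigma (S m) <= G%:E)%E.
  have /dyadic_cellP[e [k [w ->]]] := Sd m; eexists; exact: growth_cell gr.
have key bet m : T m != 0 -> log_ratio hnu sigma (S m) \is a fin_num ->
    (forall i, T m * (rinv p - b i * (rinv p + inv_delta_s / 2)) <=
       T m * (rinv p - bet * (rinv p + inv_delta_s / 2))) ->
    rinv q * fine (log_ratio hnu sigma (S m)) * T m <= ln (C * (N%:R * (54 * 18))) +
      T m * (rinv p - bet * (rinv p + inv_delta_s / 2)).
  move=> Tm0 Lf hb; have [G mG] := fin_sigma m.
  have [v [sv v0 vE]] := log_ratio_fin (TP m) Tm0 mG Lf.
  rewrite -mulrA vE; have [e [k [w [SE TE]]]] := TP m.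
  by rewrite TE in hb *; rewrite SE in sv; exact: tent_inequality ineq sv v0 hb.
have hi : rinv q * rinv dlow <=
    rinv p - (\big[Num.min/1]_(i < N) b i) * (rinv p + inv_delta_s / 2).
  have Ty := level_to_pinfty (fun n => TP n%:Z) dSy.
  have /fine_cvgP[Lf Lc] := Ldlow.
  apply: (@limit_slope (fun n => rinv q * fine (log_ratio hnu sigma (S n%:Z)))
    (fun n => T n%:Z) _ (ln (C * (N%:R * (54 * 18))))) => //; first by apply: cvgMr.
  near=> n; have T0 : 0 < T n%:Z by near: n; exact: Ty.
  apply: key; first by rewrite gt_eqF.
  - by near: n.
  - move=> i; rewrite ler_pM2l// lerD2l lerN2 ler_pM2r//; exact: bigmin_le.
have lo : rinv p - (\big[Num.max/0]_(i < N) b i) * (rinv p + inv_delta_s / 2) <=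
    rinv q * rinv dup.
  have Ty := level_to_ninfty (fun n => TP (- n%:Z)) dS0.
  have /fine_cvgP[Lf Lc] := Ldup.
  (* Here T tends to minus infinity; both sides are negated so that [limit_slope] applies with -
     T. *)
  rewrite -lerN2.
  apply: (@limit_slope (fun n => - (rinv q * fine (log_ratio hnu sigma (S (- n%:Z)))))
    (fun n => - T (- n%:Z)) _ (ln (C * (N%:R * (54 * 18))))) => //.
    by apply: cvgN; apply: cvgMr.
  near=> n; have T0 : 0 < - T (- n%:Z) by near: n; exact: Ty.
  rewrite !mulrNN; apply: key; first by rewrite lt_eqF// -oppr_gt0.
  - by near: n.
  - move=> i; rewrite ler_nM2l -?oppr_gt0// lerD2l lerN2 ler_pM2r//; exact: le_bigmax.
split.
- rewrite le_max; apply/orP; left; rewrite ler_pdivlMr//; lra.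
- rewrite /sobolev_exponent ge_max !le_max lexx orbT andbT ler_pM2r ?invr_gt0//.
  rewrite lerD2l lerN2 ler_wpM2l ?rinv_le//.
    by case/andP: (rinv_bounds q1).
- rewrite /sobolev_exponent ge_max bigmax_ge_id andbT ler_pdivrMr//; lra.
Unshelve. all: by end_near. Qed.

End Optimality.

Theorem theorem3p6 (R : realType)
    (nu : probability (R * R)%type R)
    (hnu : {measure set (R * R)%type -> \bar R})
    (nuP : is_gasket_measure nu) (hnuP : is_hgasket_measure nu hnu) :
  (forall Csigma : R, 1 <= Csigma ->
   exists2 C : R, 0 < C &
   forall (p q dlow dup : \bar R)
     (sigma : {measure set (R * R)%type -> \bar R}),
   (1 <= p)%E -> (p <= q)%E -> (2%:E <= q)%E ->
   (0 < dlow)%E -> (dlow <= dup)%E -> (1 <= dup)%E ->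
   sigma (~` hgasket) = 0%E ->
   dyadic_growth hnu sigma Csigma dlow dup ->
   forall u : R * R -> R, form_domain hnu u ->
     (hLnorm sigma q u <=
        C%:E * (sobolev_term hnu p (sobolev_exponent p q dup) u +
                sobolev_term hnu p (sobolev_exponent p q dlow) u))%E)
  /\
  (forall (Csigma : R) (p q dlow dup : \bar R)
     (sigma : {measure set (R * R)%type -> \bar R}),
   1 <= Csigma ->
   (1 <= p)%E -> (p <= q)%E -> (2%:E <= q)%E ->
   (0 < dlow)%E -> (dlow <= dup)%E -> (1 <= dup)%E ->
   sigma (~` hgasket) = 0%E ->
   dyadic_growth hnu sigma Csigma dlow dup ->
   forall S : int -> set (R * R),
   (forall m : int, dyadic_triangle (S m)) ->
   diam (S (- n%:Z)) @[n --> \oo] --> 0%E ->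
   diam (S n%:Z) @[n --> \oo] --> +oo%E ->
   log_ratio hnu sigma (S (- n%:Z)) @[n --> \oo] --> (dup^-1)%E ->
   log_ratio hnu sigma (S n%:Z) @[n --> \oo] --> (dlow^-1)%E ->
   forall (N : nat) (b : 'I_N -> R) (C : R),
   (0 < N)%N -> (forall i : 'I_N, 0 <= b i <= 1) -> 0 < C ->
   (forall u : R * R -> R, form_domain hnu u ->
      (hLnorm sigma q u <=
         C%:E * \sum_(i < N) sobolev_term hnu p (b i) u)%E) ->
   [/\ \big[Num.min/1]_(i < N) b i <= sobolev_exponent p q dlow,
       sobolev_exponent p q dlow <= sobolev_exponent p q dup &
       sobolev_exponent p q dup <= \big[Num.max/0]_(i < N) b i]).
Proof.
split=> [C C1|C p q dlow dup sigma _ p1 pq _ dl0 dlu du1 _ gr].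
  exists (26 * C) => [|p q dlow dup sigma p1 pq q2 dl0 dlu du1 _ gr u fu].
    by rewrite mulr_gt0//; lra.
  exact: (sobolev_inequality nuP hnuP).
exact: (optimality nuP hnuP p1 pq dl0 dlu du1 gr).
Qed.
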